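(* Let $a,b,c>0$. For $(\mathbf{x},t)\in\overline{\mathbb{R}_+^2}\times\mathbb{R}_+$ let $$J(\mathbf{x},t)=\inf\left\{\int_0^t\big(L(-\eta(\tau))+F(\gamma,\eta,l)(\tau)\big)\,d\tau\ :\ (\gamma,\eta,l)\in\mathbb{Y}^{\mathbf{x},t},\ \gamma(t)=(0,0)\right\},$$ $$v(\mathbf{x},t)=\sup_{\theta\in\Theta}\ \inf_{(\gamma,\eta,l)\in\mathbb{Y}^{\mathbf{x},t},\ \gamma(t)=(0,0)}\ \int_0^{t\wedge\theta[\gamma]}\big(L(-\eta(\tau))+F(\gamma,\eta,l)(\tau)\big)\,d\tau,$$ and $P:=\{(\mathbf{x},t)\in\overline{\mathbb{R}_+^2}\times\mathbb{R}_+:\ J(\mathbf{x},t)>0\}$. Then $J$ satisfies Freidlin's condition: for any $(\mathbf{x},t)\in\partial P$ (boundary relative to $\overline{\mathbb{R}_+^2}\times\mathbb{R}_+$), $$J(\mathbf{x},t)=\inf\left\{\int_0^t\big(L(-\eta(\tau))+F(\gamma,\eta,l)(\tau)\big)\,d\tau\ :\ (\gamma,\eta,l)\in\mathbb{Y}^{\mathbf{x},t},\ \gamma(t)=(0,0),\ (\gamma(\tau),t-\tau)\in P\ \text{for } 0<\tau<t\right\}.$$ Consequently, $v=\max\{0,J\}$ on $\overline{\mathbb{R}_+^2}\times\mathbb{R}_+$.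
   Context: Notation: $\mathbb{R}_+=(0,\infty)$, $\overline{\mathbb{R}_+^2}=\mathbb{R}\times[0,\infty)$; $s\wedge t=\min\{s,t\}$. For $q=(q_1,q_2)\in\mathbb{R}^2$, $L(q)=\frac{|q|^2}{4}-\frac{c}{2}q_1+\frac{c^2}{4}-1$; for $q_1\in\mathbb{R}$, $G(q_1)=\frac{(q_1-b)^2}{4a}$. Control triplets: for $\mathbf{x}\in\overline{\mathbb{R}_+^2}$, $t>0$, $\mathbb{Y}^{\mathbf{x},t}$ is the set of triplets $(\gamma,\eta,l)$ with $\gamma=(\gamma_1,\gamma_2)$ absolutely continuous from $[0,t]$ to $\overline{\mathbb{R}_+^2}$, $\eta=(\eta_1,\eta_2)\in L^1([0,t],\mathbb{R}^2)$, $l\in L^1([0,t],\mathbb{R})$, such that: $\gamma(0)=\mathbf{x}$; for a.e. $\tau\in[0,t]$, $l(\tau)\ge0$, and $l(\tau)=0$ if $\gamma_2(\tau)\ne0$; the function $F(\gamma,\eta,l)(\tau):=l(\tau)\,G\big(\frac{\eta_1(\tau)-\dot\gamma_1(\tau)}{l(\tau)}\big)$ is integrable on $[0,t]$, where this expression means $\frac{(\eta_1-\dot\gamma_1-bl)^2(\tau)}{4a\,l(\tau)}$ if $l(\tau)>0$ and $0$ if $l(\tau)=0$; for a.e. $\tau$, $\dot\gamma(\tau)=\eta(\tau)$ if $l(\tau)=0$, and $\eta_2(\tau)=\dot\gamma_2(\tau)-l(\tau)$ if $l(\tau)\ne0$. Stopping times: $\Theta$ is the set of all maps $\theta:L^2([0,\infty);\overline{\mathbb{R}_+^2})\to[0,\infty)$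 such that for all $\gamma,\hat\gamma$ and all $s\in[0,\infty)$: if $\gamma=\hat\gamma$ a.e. on $[0,s]$ and $\theta[\gamma]\le s$, then $\theta[\gamma]=\theta[\hat\gamma]$. For a path $\gamma$ defined only on $[0,t]$, $\theta[\gamma]$ is evaluated on any extension in $L^2([0,\infty);\overline{\mathbb{R}_+^2})$ (by the stopping-time property, $t\wedge\theta[\gamma]$ does not depend on the extension). *)

(* Defs.v *)
From HB Require Import structures.
From mathcomp Require Import all_boot all_order all_algebra.
From mathcomp Require Import all_classical all_reals all_analysis.
From mathcomp Require Import measurable_realfun.

Set Implicit Arguments.
Unset Strict Implicit.
Unset Printing Implicit Defensive.

Import Order.TTheory GRing.Theory Num.Theory.
Import numFieldNormedType.Exports.

Local Open Scope classical_set_scope.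
Local Open Scope ring_scope.

Definition half_plane (R : realType) : set (R * R) := [set x | 0 <= x.2].

(* Relative boundary of A in X, for A `<=` X; `closure` is taken in the ambient
   space, and X `&` closure B is the closure of B relative to X. *)
Definition rel_boundary (T : topologicalType) (X A : set T) : set T :=
  X `&` closure A `&` closure (X `\` A).

Definition abs_continuous (R : realType) (s t : R) (f : R -> R) : Prop :=
  forall e : R, 0 < e -> exists2 d : R, 0 < d &
    forall (n : nat) (u v : nat -> R),
      (forall i, (i < n)%N -> [/\ s <= u i, u i <= v i & v i <= t]) ->
      trivIset [set i | (i < n)%N] (fun i => `]u i, v i[%classic) ->
      \sum_(i < n) (v i - u i) < d ->
      \sum_(i < n) `|f (v i) - f (u i)| < e.

Definition Lagr (R : realType) (c : R) (q : R * R) : R :=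
  (q.1 ^+ 2 + q.2 ^+ 2) / 4 - c / 2 * q.1 + c ^+ 2 / 4 - 1.

Definition Gcost (R : realType) (a b q1 : R) : R :=
  (q1 - b) ^+ 2 / (4 * a).

(* Only the values on [0, t] of the three functions matter for triplets in
   Y^{x,t}; no condition is imposed elsewhere. *)
Record triplet (R : realType) := Triplet {
  gam : R -> R * R ;
  eta : R -> R * R ;
  ell : R -> R }.

(* Time derivatives of the coordinates of gam; `derive1` takes a default value
   where gam is not differentiable, which is a null set when gam is absolutely
   continuous. *)
Definition dgam1 (R : realType) (u : triplet R) : R -> R :=
  derive1 (fun s => (gam u s).1).
Definition dgam2 (R : realType) (u : triplet R) : R -> R :=
  derive1 (fun s => (gam u s).2).

(* On the null set where ell is negative the value 0 is used as well. *)
Definition Fcost (R : realType) (a b : R) (u : triplet R) (s : R) : R :=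
  if 0 < ell u s
  then ell u s * Gcost a b (((eta u s).1 - dgam1 u s) / ell u s)
  else 0.

(* L^1 is rendered by Borel representatives: mu.-integrable includes Borel
   measurability on the domain. *)
Record control_triplet (R : realType) (a b : R) (x : R * R) (t : R)
    (u : triplet R) : Prop := ControlTriplet {
  ct_ac1 : abs_continuous 0 t (fun s => (gam u s).1) ;
  ct_ac2 : abs_continuous 0 t (fun s => (gam u s).2) ;
  ct_half_plane : forall s, s \in `[0, t] -> half_plane (gam u s) ;
  ct_eta1 : lebesgue_measure.-integrable `[0, t]
              (fun s => ((eta u s).1)%:E) ;
  ct_eta2 : lebesgue_measure.-integrable `[0, t]
              (fun s => ((eta u s).2)%:E) ;
  ct_ell : lebesgue_measure.-integrable `[0, t]
             (fun s => (ell u s)%:E) ;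
  ct_start : gam u 0 = x ;
  ct_refl : {ae lebesgue_measure, forall s : R, s \in `[0, t] ->
              0 <= ell u s /\ ((gam u s).2 != 0 -> ell u s = 0)} ;
  ct_Fcost : lebesgue_measure.-integrable `[0, t]
               (fun s => (Fcost a b u s)%:E) ;
  ct_dyn : {ae lebesgue_measure, forall s : R, s \in `[0, t] ->
              (ell u s = 0 -> (dgam1 u s, dgam2 u s) = eta u s) /\
              (ell u s != 0 -> (eta u s).2 = dgam2 u s - ell u s)} }.

Definition bridge (R : realType) (a b : R) (x : R * R) (t : R) :
    set (triplet R) :=
  [set u | control_triplet a b x t u /\ gam u t = (0, 0)].

(* Values in ]-oo, +oo]: Lagr c >= -1, Fcost >= 0, and eta need not be square
   integrable. *)
Definition cost (R : realType) (a b c : R) (u : triplet R) (s : R) : \bar R :=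
  (\int[lebesgue_measure]_(r in `[0%R, s])
     (Lagr c (- (eta u r)) + Fcost a b u r)%:E)%E.

Definition J (R : realType) (a b c : R) (x : R * R) (t : R) : \bar R :=
  ereal_inf [set cost a b c u t | u in bridge a b x t].

Definition spacetime (R : realType) : set ((R * R) * R) :=
  [set z | half_plane z.1 /\ 0 < z.2].

Definition Pset (R : realType) (a b c : R) : set ((R * R) * R) :=
  spacetime (R := R) `&` [set z | (0 < J a b c z.1 z.2)%E].

(* Representatives of the elements of L^2([0, oo); half plane). *)
Definition L2path (R : realType) (g : R -> R * R) : Prop :=
  [/\ (fun s => (g s).1) \_ `[0, +oo[ \in Lfun lebesgue_measure 2%:E,
      (fun s => (g s).2) \_ `[0, +oo[ \in Lfun lebesgue_measure 2%:E &
      forall s, 0 <= s -> half_plane (g s)].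

(* theta acts on representatives; the second clause with s := theta g forces it
   to be invariant under a.e. equality on [0, oo), so that it is the same as a
   map on L^2 classes.  Values outside L2path are irrelevant. *)
Definition stopping_time (R : realType) (theta : (R -> R * R) -> R) : Prop :=
  (forall g, L2path g -> 0 <= theta g) /\
  (forall (g h : R -> R * R) (s : R), L2path g -> L2path h -> 0 <= s ->
     {ae lebesgue_measure, forall r : R, r \in `[0, s] -> g r = h r} ->
     theta g <= s -> theta g = theta h).

(* An extension of a path on [0, t] to [0, oo).  By L2path_extend and
   stopping_time_extend below, the choice of the extension is irrelevant for
   the minimum of t and theta. *)
Definition extend (R : realType) (t : R) (g : R -> R * R) : R -> R * R :=
  fun s => if s <= t then g s else (0, 0).

Definition value (R : realType) (a b c : R) (x : R * R) (t : R) : \bar R :=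
  ereal_sup [set
    ereal_inf [set cost a b c u (Num.min t (theta (extend t (gam u))))
              | u in bridge a b x t]
    | theta in @stopping_time R].

Definition J_in_P (R : realType) (a b c : R) (x : R * R) (t : R) : \bar R :=
  ereal_inf [set cost a b c u t | u in
    bridge a b x t `&`
    [set u | forall s, 0 < s < t -> Pset a b c (gam u s, t - s)]].

Lemma abs_continuous_within (R : realType) (t : R) (f : R -> R) :
  abs_continuous 0 t f -> {within `[0, t], continuous f}.
Proof.
move=> acf; apply/subspace_continuousP => x x0t.
apply/cvgrPdist_lt => e e0; have [d d0 fd] := acf e e0.
rewrite near_withinE; near=> y => y0t.
move: x0t y0t; rewrite /= !in_itv/= => /andP[x0 xt] /andP[y0 yt].
have yx : `|x - y| < d.
  by near: y; exact: (@cvgr_dist_lt _ _ _ (nbhs x) _ id x _ d d0).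
have := fd 1 (fun=> Num.min x y) (fun=> Num.max x y).
rewrite !big_ord1 => h; case: (leP x y) h => [xy|/ltW xy] h.
- rewrite distrC; apply: h.
  + by move=> _ _; split.
  + by move=> [|i] [|j] //= _ _.
  + by rewrite (le_lt_trans (ler_norm _))// distrC.
- apply: h.
  + by move=> _ _; split.
  + by move=> [|i] [|j] //= _ _.
  + by rewrite (le_lt_trans (ler_norm _)).
Unshelve. all: by end_near. Qed.

Lemma within_continuous_Lfun2 (R : realType) (t : R) (f : R -> R) :
  {within `[0, t], continuous f} ->
  f \_ `[0, t] \in Lfun (@lebesgue_measure R) 2%:E.
Proof.
move=> cf; rewrite inE; apply/andP; split.
  rewrite inE/=; apply/(measurable_restrictT _ _).1 => //.
  exact: subspace_continuous_measurable_fun.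
rewrite inE/= /finite_norm unlock /Lnorm; apply: poweR_lty.
have -> : (\int[@lebesgue_measure R]_x
    `| (EFin \o f \_ `[0%R, t]) x | `^ 2 =
    \int[@lebesgue_measure R]_(x in `[0%R, t]) ((f x) ^+ 2)%:E)%E.
  rewrite [RHS]integral_mkcond; apply: eq_integral => x _ /=.
  rewrite !patchE; case: ifPn => _ /=.
    by rewrite powR_mulrn// real_normK ?num_real.
  by rewrite normr0 powR0.
have cf2 : {within `[0, t], continuous (fun x => f x ^+ 2)}.
  move=> x; exact: (cvgM (cf x) (cf x)).
have /integrableP[_] :=
  continuous_compact_integrable (@segment_compact R 0 t) cf2.
congr (_ < _)%E; apply: eq_integral => x _ /=.
by rewrite ger0_norm ?sqr_ge0.
Qed.

Lemma L2path_extend (R : realType) (a b t : R) (x : R * R) (u : triplet R) :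
  control_triplet a b x t u -> L2path (extend t (gam u)).
Proof.
move=> ct.
have E (f : R -> R) (h : R -> R) : (forall s, 0 <= s -> h s = if s <= t then f s else 0) ->
    h \_ `[0, +oo[ = f \_ `[0, t].
  move=> hf; apply/funext => s; rewrite !patchE.
  case: ifPn; rewrite ?inE ?notin_setE/= ?in_itv/= ?andbT => s0.
    by rewrite hf//; case: ifPn => st; case: ifPn => //;
      rewrite ?inE ?notin_setE/= in_itv/= s0 ?st// (negbTE st).
  by case: ifPn => //; rewrite inE/= in_itv/= => /andP[/s0].
split.
- rewrite (E (fun s => (gam u s).1)); last first.
    by move=> s _; rewrite /extend; case: ifP.
  exact/within_continuous_Lfun2/abs_continuous_within/(ct_ac1 ct).
- rewrite (E (fun s => (gam u s).2)); last first.
    by move=> s _; rewrite /extend; case: ifP.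
  exact/within_continuous_Lfun2/abs_continuous_within/(ct_ac2 ct).
- move=> s s0; rewrite /extend; case: ifPn => [st|_]; last exact: lexx.
  by apply: (ct_half_plane ct); rewrite in_itv/= s0.
Qed.

Lemma stopping_time_extend (R : realType) (theta : (R -> R * R) -> R) (t : R)
    (g h : R -> R * R) :
  0 <= t -> stopping_time theta -> L2path g -> L2path h ->
  {ae lebesgue_measure, forall r : R, r \in `[0, t] -> g r = h r} ->
  Num.min t (theta g) = Num.min t (theta h).
Proof.
move=> t0 [_ st] Lg Lh gh.
have hg : {ae lebesgue_measure, forall r : R, r \in `[0, t] -> h r = g r}.
  apply: (@filterS _ _ (ae_filter_ringOfSetsType (@lebesgue_measure R)) _ _ _ gh).
  by move=> /= r ghr r0t; rewrite ghr.
have [le|lt] := leP (theta g) t.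
  by rewrite -(st g h t)// min_r.
have [le'|lt'] := leP (theta h) t.
  by move: lt; rewrite -(st h g t)// ltNge le'.
by [].
Qed.

(* Main.v *)
From HB Require Import structures.
Require Import Defs.
From mathcomp Require Import all_boot all_order all_algebra.
From mathcomp Require Import all_classical all_reals all_analysis.
From mathcomp Require Import measurable_realfun ring lra.

Import Order.TTheory GRing.Theory Num.Theory.
Import numFieldNormedType.Exports.

Set Implicit Arguments.
Unset Strict Implicit.
Unset Printing Implicit Defensive.

Local Open Scope classical_set_scope.
Local Open Scope ring_scope.

(**
The drift [c] is absorbed by measuring positions relative to [c * t]; in the
field the running cost of the velocity [v] is then [|v|^2 / 4 - 1].

Lower bounds on the action are affine.  Call [(p, r)] admissible when [0 <= r]
and [a p^2 - b p <= r].  For every control triplet the running cost is almost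
everywhere at least
[p (gamma_1' + c) - r gamma_2' - (1 + p^2 + r^2)]: in the field this is
completing two squares; on the road [gamma_2' = 0], and what a reflection rate
[l] can gain there is at most [l (a p^2 - b p) - l^2 / 4 <= r^2]
([field_cost_ge], [road_cost_ge]).  Integrating gives [calibration_le_cost].
This uses the fundamental theorem of calculus for absolutely continuous
functions ([abs_continuous_density], [density_derivable]): the total variation
of such a function is again absolutely continuous, so the function is a
difference of monotone functions whose Stieltjes measures are dominated by the
Lebesgue measure; Radon-Nikodym and Lebesgue differentiation conclude.

These bounds are sharp.  Every [(x, t)] has a slope [p] solving the stationarity
equation of [critical_slope], and with [g = a p^2 - b p] it names an explicit
trajectory: the segment from [x] to the origin if [g <= x_2 / (2 t)], and
otherwise a segment to the road followed by a motion along the road at constant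
speed.  Its cost is the calibration of [(p, r)], where [r] is the
larger of [g] and [x_2 / (2 t)]; hence [J] is that calibration ([optimal_J]).

On entering the road the running cost of this trajectory jumps up, by
[2 g a p^2].  Its accumulated cost is therefore convex in time, so it never
exceeds [max 0 J]: stopping early does not help, whatever the stopping time, and
[v <= max 0 J].  The stopping times [0] and [t] give the converse.

At a relative boundary point of [P] one has [J = 0] ([boundary_optimal0]), and by
the same convexity the accumulated cost along the optimal trajectory stays
nonpositive, so that what remains to be paid, the calibration at
[(gamma s, t - s)], stays nonnegative.  Adding [d s (t - s)] times [(-p, r)] to
the trajectory (only its horizontal part if the road is used) makes this
calibration, hence [J], strictly positive for [0 < s < t], that is keeps the
trajectory in [P], while the cost increases only by a multiple of [d^2].
*)

(** * Absolute continuity of the total variation *)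

Section Chains.
Context {R : realType}.
Implicit Types (lo mid hi a b t : R) (s : seq (R * R)) (f : R -> R).

(** Consecutive intervals [[u, v]] of a list lie between [lo] and [hi] and
    follow each other; such lists concatenate and can be refined, which is how
    absolute continuity is transferred to the total variation. *)
Fixpoint chain lo hi s : bool :=
  if s is p :: s' then [&& lo <= p.1, p.1 <= p.2 & chain p.2 hi s']
  else lo <= hi.

Definition increments f s := \sum_(p <- s) (f p.2 - f p.1).
Definition abs_increments f s := \sum_(p <- s) `|f p.2 - f p.1|.

Lemma chain_le lo hi s : chain lo hi s -> lo <= hi.
Proof.
elim: s lo => //= p s ih lo /and3P[lp pp /ih].
by apply: le_trans; exact: le_trans pp.
Qed.

Lemma chainW lo lo' hi s : lo' <= lo -> chain lo hi s -> chain lo' hi s.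
Proof.
case: s => [|p s] /= ll; first exact: le_trans.
by move=> /and3P[lp -> ->]; rewrite (le_trans ll lp).
Qed.

Lemma chain_cat lo mid hi s1 s2 :
  chain lo mid s1 -> chain mid hi s2 -> chain lo hi (s1 ++ s2).
Proof.
elim: s1 lo => /= [lo lm|p s ih lo /and3P[-> -> /ih h] /h//].
exact: chainW.
Qed.

Lemma chain_nth lo hi s i : chain lo hi s -> (i < size s)%N ->
  [/\ lo <= (nth 0 s i).1, (nth 0 s i).1 <= (nth 0 s i).2 &
      (nth 0 s i).2 <= hi].
Proof.
elim: s lo i => //= p s ih lo [|i] /and3P[lp pp c] /=; rewrite ?ltnS => si.
  by rewrite lp pp (chain_le c).
have [h -> ->] := ih _ _ c si.
by rewrite (le_trans _ h)// (le_trans lp).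
Qed.

Lemma chain_nth_lt lo hi s i j : chain lo hi s -> (i < j < size s)%N ->
  (nth 0 s i).2 <= (nth 0 s j).1.
Proof.
elim: s lo i j => [|p s ih] lo i [|j]; rewrite /= ?ltn0 ?andbF//.
move=> /and3P[lp pp c]; case: i => [|i] /=.
  by rewrite ltnS => /(chain_nth c)[].
by rewrite !ltnS => ij; exact: ih c ij.
Qed.

Definition chain_continuous t f :=
  forall e, 0 < e -> exists2 d, 0 < d & forall s, chain 0 t s ->
    increments id s < d -> increments f s <= e.

Lemma abs_continuous_chain lo hi f : abs_continuous lo hi f ->
  forall e, 0 < e -> exists2 d, 0 < d & forall s, chain lo hi s ->
    increments id s < d -> abs_increments f s < e.
Proof.
move=> acf e e0; have [d d0 fd] := acf e e0; exists d => // s cs.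
have sumE (F : R * R -> R) : \sum_(p <- s) F p = \sum_(i < size s) F (nth 0 s i).
  by rewrite (big_nth 0) big_mkord.
rewrite /increments /abs_increments (sumE (fun p => id p.2 - id p.1)).
rewrite (sumE (fun p => `|f p.2 - f p.1|)) => sd.
pose u i := (nth 0 s i).1; pose v i := (nth 0 s i).2.
have uv i : (i < size s)%N -> [/\ lo <= u i, u i <= v i & v i <= hi].
  exact: (chain_nth cs).
apply: (fd (size s) u v uv _ sd).
have dis i j : (i < j < size s)%N -> `]u i, v i[ `&` `]u j, v j[ = set0.
  move=> ij; rewrite -subset0 => x [] /=.
  rewrite !in_itv/= => /andP[_ xi] /andP[xj _].
  by have := lt_trans xj xi; rewrite ltNge (chain_nth_lt cs).
apply/trivIsetP => i j /= si sj; rewrite neq_ltn => /orP[ij|ji].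
  by apply: dis; rewrite ij.
by rewrite setIC; apply: dis; rewrite ji.
Qed.

Lemma itv_partition_chain a b l f : itv_partition a b l ->
  let s := zip (a :: l) l in
  [/\ chain a b s, increments id s = b - a & abs_increments f s = variation a b f l].
Proof.
move=> abl; rewrite variation_zip//; move: abl => [+ /eqP].
rewrite /increments /abs_increments.
elim: l a => [|c l ih] a /=; first by move=> _ ->; rewrite !big_nil subrr.
move=> /andP[ac cl] lb; have [h1 h2 h3] := ih c cl lb.
rewrite !big_cons /= h2 h3 lexx (ltW ac) h1; split => //.
by rewrite addrC addrA subrK.
Qed.

Lemma total_variation_chain a b f (M : R) : a <= b ->
  (M%:E < total_variation a b f)%E ->
  exists s, [/\ chain a b s, increments id s = b - a & M < abs_increments f s].
Proof.
move=> ab /ereal_sup_gt[_ [_ [l abl <-] <-]]; rewrite lte_fin => Ml.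
have [h1 h2 h3] := itv_partition_chain f abl.
by exists (zip (a :: l) l); rewrite h3.
Qed.

(** On an interval shorter than the modulus for [1] every variation is less than
    [1], and finitely many such intervals cover [[0, t]]. *)
Lemma abs_continuous_bounded_variation t f : 0 <= t -> abs_continuous 0 t f ->
  bounded_variation 0 t f.
Proof.
move=> t0 acf; apply/bounded_variationP => //.
have [d d0 fd] := abs_continuous_chain acf ltr01.
have d20 : 0 < d / 2 by rewrite divr_gt0.
have step x y : 0 <= x -> x <= y -> y <= t -> y - x < d ->
    total_variation x y f \is a fin_num.
  move=> x0 xy yt yxd; rewrite ge0_fin_numE ?total_variation_ge0//.
  apply: (@le_lt_trans _ _ 1%:E); last exact: ltry.
  rewrite leNgt; apply/negP => /(total_variation_chain xy)[s [cs sl]].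
  apply/negP; rewrite -leNgt; apply/ltW/fd; last by rewrite sl.
  apply: (chainW x0); rewrite -(cats0 s).
  exact: chain_cat cs _.
suff H n y : 0 <= y <= t -> y <= n%:R * (d / 2) ->
    total_variation 0 y f \is a fin_num.
  apply: (H (Num.bound (t / (d / 2)))); first by rewrite t0 lexx.
  by rewrite -ler_pdivrMr//; apply/ltW/archi_boundP; rewrite divr_ge0// ltW.
elim: n y => [|n ih] y /andP[y0 yt].
  rewrite mul0r => y0'; have -> : y = 0 by apply/eqP; rewrite eq_le y0 y0'.
  by rewrite total_variationxx.
move=> yn; have [yd|dy] := leP y (d / 2).
  by apply: step => //; rewrite subr0; lra.
rewrite (@total_variationD _ _ _ (y - d / 2))//; [|lra|lra].
rewrite fin_numD ih/=; last 2 first.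
- by apply/andP; split; lra.
- by move: yn; rewrite -natr1; lra.
by apply: step => //; lra.
Qed.

Lemma total_variation_fin_num t f x y : bounded_variation 0 t f ->
  0 <= x -> x <= y -> y <= t -> total_variation x y f \is a fin_num.
Proof.
move=> bf x0 xy yt; apply/bounded_variationP => //.
apply: (bounded_variationl _ yt); first exact: xy.
by apply: (bounded_variationr x0 _ bf); exact: le_trans yt.
Qed.

Definition tv_upto f x := fine (total_variation 0 x f).

Lemma tv_uptoB t f x y : bounded_variation 0 t f ->
  0 <= x -> x <= y -> y <= t ->
  tv_upto f y - tv_upto f x = fine (total_variation x y f).
Proof.
move=> bf x0 xy yt; rewrite /tv_upto (total_variationD f x0 xy) fineD.
- by rewrite addrC addKr.
- by apply: (total_variation_fin_num bf) => //; exact: le_trans yt.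
- exact: (total_variation_fin_num bf).
Qed.

Lemma le_tv_upto t f x y : bounded_variation 0 t f ->
  0 <= x -> x <= y -> y <= t -> `|f y - f x| <= tv_upto f y - tv_upto f x.
Proof.
move=> bf x0 xy yt; rewrite (tv_uptoB bf)// -lee_fin fineK.
  exact: total_variation_ge.
exact: (total_variation_fin_num bf).
Qed.

(** Refine each interval of the chain by a partition that nearly attains the total
    variation of [f] there; the refined chain has the same total length. *)
Lemma tv_upto_chain t f lo s (e : R) : bounded_variation 0 t f -> 0 < e ->
  0 <= lo -> chain lo t s ->
  exists s', [/\ chain lo t s', increments id s' = increments id s &
    increments (tv_upto f) s <= abs_increments f s' + e *+ size s].
Proof.
move=> bf e0; rewrite /increments /abs_increments.
elim: s lo => [|p s ih] lo lo0 /=.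
  by exists [::]; rewrite !big_nil mulr0n addr0.
move=> /and3P[lp pp /[dup] cs /ih [|s' [c1 i1 a1]]].
  by rewrite (le_trans lo0)// (le_trans lp).
have p0 : 0 <= p.1 by rewrite (le_trans lo0).
have pt : p.2 <= t := chain_le cs.
have : ((fine (total_variation p.1 p.2 f) - e)%:E < total_variation p.1 p.2 f)%E.
  rewrite -[ltRHS]fineK; last exact: (total_variation_fin_num bf).
  by rewrite lte_fin; lra.
move=> /(total_variation_chain pp)[s2 [c2 i2 a2]]; exists (s2 ++ s').
split; first exact: chainW lp (chain_cat c2 c1).
  by rewrite big_cat big_cons /= i1; congr (_ + _).
rewrite big_cat big_cons /= (tv_uptoB bf)// mulrS.
rewrite /abs_increments in a2; lra.
Qed.

(** The modulus of [f] serves for its total variation as well, because a chain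
    and its refinements have the same length. *)
Lemma chain_continuous_tv_upto t f : 0 <= t -> abs_continuous 0 t f ->
  chain_continuous t (tv_upto f).
Proof.
move=> t0 acf e e0; have bf := abs_continuous_bounded_variation t0 acf.
have [d d0 fd] := abs_continuous_chain acf e0; exists d => // s cs sd.
apply/ler_addgt0Pr => e' e'0.
have n0 : 0 < (size s).+1%:R :> R by rewrite ltr0n.
have e2 : 0 < e' / (size s).+1%:R by rewrite divr_gt0.
have [s' [c1 i1 h]] := tv_upto_chain bf e2 (lexx 0) cs.
apply: (le_trans h); apply: lerD; first by apply/ltW/fd; rewrite ?i1.
rewrite -[_ *+ size s]mulr_natr -mulrA ger_pMr// mulrC ler_pdivrMr// mul1r.
by rewrite ler_nat.
Qed.

End Chains.

(** * Stieltjes measure of unions of dyadic cells *)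

Section StieltjesChains.
Context {R : realType}.
Implicit Types (lo hi a b t x : R) (s : seq (R * R)).

Lemma chain_filter (P : pred (R * R)) lo hi s :
  chain lo hi s -> chain lo hi [seq p <- s | P p].
Proof.
elim: s lo => //= p s ih lo /and3P[lp pp /ih c].
case: ifP => _ /=; first by rewrite lp pp.
by apply: chainW c; exact: le_trans pp.
Qed.

Definition chain_set s : set R := \bigcup_(p in [set` s]) `]p.1, p.2]%classic.

Lemma chain_set_cons p s : chain_set (p :: s) = `]p.1, p.2]%classic `|` chain_set s.
Proof.
apply/seteqP; split => x.
  by move=> [q /=]; rewrite inE => /predU1P[->|qs] h; [left|right; exists q].
move=> [h|[q qs h]]; first by exists p => //=; rewrite mem_head.
by exists q => //=; rewrite inE qs orbT.
Qed.

Lemma chain_set_nil : chain_set [::] = set0.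
Proof. by rewrite -subset0 => x []. Qed.

Lemma measurable_chain_set s : measurable (chain_set s).
Proof.
elim: s => [|p s ih]; first by rewrite chain_set_nil.
by rewrite chain_set_cons; apply: measurableU.
Qed.

Lemma lebesgue_stieltjes_itv_oc (F : cumulative R R) a b : a <= b ->
  lebesgue_stieltjes_measure F `]a, b]%classic = (F b - F a)%:E.
Proof.
move=> ab; rewrite /lebesgue_stieltjes_measure /measure_extension.
rewrite measurable_mu_extE/=; last exact: is_ocitv.
by rewrite (@wlength_itv_bnd _ F a b false false ab).
Qed.

(** The half-open cells of a chain are disjoint, so measures add up.  For the
    identity this is the Lebesgue measure of the union. *)
Lemma lebesgue_stieltjes_chain (F : cumulative R R) lo hi s : chain lo hi s ->
  lebesgue_stieltjes_measure F (chain_set s) = (increments F s)%:E.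
Proof.
rewrite /increments; elim: s lo => [|p s ih] lo.
  by rewrite chain_set_nil big_nil measure0.
move=> /= /and3P[lp pp c].
rewrite chain_set_cons measureU; first last.
- rewrite -subset0 => x [] /=; rewrite in_itv/= => /andP[_ xp] [q /= qs].
  rewrite in_itv/= => /andP[qx _].
  have [i si] := nthP 0 qs => qE; subst q.
  have [h _ _] := chain_nth c si.
  by have := le_lt_trans h qx; rewrite ltNge xp.
- exact: measurable_chain_set.
- exact: measurable_itv.
rewrite big_cons EFinD; congr (_ + _)%E; last exact: ih c.
exact: lebesgue_stieltjes_itv_oc.
Qed.

Definition dyadic_pt t n k : R := t * k%:R / 2 ^+ n.
Definition dyadic t n k : R * R := (dyadic_pt t n k, dyadic_pt t n k.+1).
Definition dyadic_grid t n := [seq dyadic t n k | k <- iota 0 (2 ^ n)].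

Lemma dyadic_pt0 t n : dyadic_pt t n 0 = 0.
Proof. by rewrite /dyadic_pt mulr0 mul0r. Qed.

Lemma dyadic_pt_last t n : dyadic_pt t n (2 ^ n) = t.
Proof. by rewrite /dyadic_pt natrX mulfK// expf_neq0. Qed.

Lemma dyadic_pt_double t n k : dyadic_pt t n.+1 k.*2 = dyadic_pt t n k.
Proof.
by rewrite /dyadic_pt -muln2 natrM exprS; field; rewrite expf_neq0.
Qed.

Lemma le_dyadic_pt t n k k' : 0 <= t -> (k <= k')%N ->
  dyadic_pt t n k <= dyadic_pt t n k'.
Proof.
move=> t0 kk; rewrite /dyadic_pt ler_pM2r ?invr_gt0 ?exprn_gt0//.
by rewrite ler_wpM2l// ler_nat.
Qed.

Lemma chain_dyadic_grid t n : 0 <= t -> chain 0 t (dyadic_grid t n).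
Proof.
move=> t0; rewrite /dyadic_grid.
suff H k m : chain (dyadic_pt t n k) (dyadic_pt t n (k + m))
    [seq dyadic t n i | i <- iota k m].
  by have := H 0 (2 ^ n)%N; rewrite dyadic_pt0 add0n dyadic_pt_last.
elim: m k => /= [k|m ih k]; first by rewrite addn0 lexx.
by rewrite lexx -addSnnS ih andbT le_dyadic_pt.
Qed.

Lemma dyadic_refine t n k x : 0 <= t ->
  `](dyadic t n k).1, (dyadic t n k).2]%classic x ->
  exists k', [/\ `](dyadic t n.+1 k').1, (dyadic t n.+1 k').2]%classic x,
   `](dyadic t n.+1 k').1, (dyadic t n.+1 k').2]%classic `<=`
      `](dyadic t n k).1, (dyadic t n k).2]%classic &
   (k < 2 ^ n -> k' < 2 ^ n.+1)%N].
Proof.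
move=> t0; rewrite /= in_itv/= -2!(dyadic_pt_double t n) => /andP[kx xk].
(* the point [k.*2.+1] of generation [n.+1] is the middle of the cell *)
have [xm|mx] := leP x (dyadic_pt t n.+1 k.*2.+1).
  exists k.*2; rewrite in_itv/= kx xm; split => //.
    move=> y /=; rewrite !in_itv/= => /andP[-> yk] /=.
    by rewrite (le_trans yk)// le_dyadic_pt.
  by rewrite expnS mul2n ltn_double.
exists k.*2.+1; rewrite in_itv/= mx xk; split => //.
  move=> y /=; rewrite !in_itv/= => /andP[ky ->]; rewrite andbT.
  by rewrite (le_lt_trans _ ky)// le_dyadic_pt.
by rewrite expnS mul2n ltn_Sdouble.
Qed.

Lemma dyadic_cover t n x : 0 < x <= t -> exists2 k, (k < 2 ^ n)%N &
  `](dyadic t n k).1, (dyadic t n k).2]%classic x.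
Proof.
move=> /[dup] xt /andP[x0 /(lt_le_trans x0)/ltW t0].
elim: n => [|n [k kn /(dyadic_refine t0)[k' [h1 _ h2]]]].
  by exists 0; rewrite //= in_itv/= dyadic_pt0 (dyadic_pt_last t 0).
by exists k' => //; exact: h2.
Qed.

Section inner_approximation.
Variables (t : R) (U : set R).
Hypothesis t0 : 0 <= t.

(** The cells of generation [n] contained in [U]; for open [U] their unions
    increase to [U `&` ]0, t]], so that [U] is exhausted by chains. *)
Definition inner_grid n :=
  [seq p <- dyadic_grid t n | asbool (`]p.1, p.2]%classic `<=` U)].

Lemma chain_inner_grid n : chain 0 t (inner_grid n).
Proof. exact/chain_filter/chain_dyadic_grid. Qed.

Lemma inner_grid_sub n : chain_set (inner_grid n) `<=` U.
Proof.
by move=> x [p /=]; rewrite mem_filter => /andP[/asboolP pU _] /pU.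
Qed.

Lemma inner_grid_nondecreasing :
  nondecreasing_seq (fun n => chain_set (inner_grid n)).
Proof.
apply/nondecreasing_seqP => n; apply/subsetPset => x [p /=].
rewrite mem_filter => /andP[/asboolP pU /mapP[k]].
rewrite mem_iota add0n => kn pE; rewrite pE in pU *.
move=> /(dyadic_refine t0)[k' [xk' sub k'n]].
exists (dyadic t n.+1 k') => //=; rewrite mem_filter; apply/andP; split.
  by apply/asboolP; exact: subset_trans pU.
by apply/mapP; exists k' => //; rewrite mem_iota add0n k'n.
Qed.

Lemma inner_grid_cover : open U ->
  U `&` `]0, t]%classic `<=` \bigcup_n chain_set (inner_grid n).
Proof.
move=> oU x [Ux]; rewrite /= in_itv/= => xt.
have /nbhs_ballP[e /= e0 eU] : nbhs x U by exact: open_nbhs_nbhs.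
pose n := Num.bound (t / e).
have tn : t / 2 ^+ n < e.
  rewrite ltr_pdivrMr ?exprn_gt0// -ltr_pdivrMl// mulrC.
  rewrite (@lt_le_trans _ _ n%:R)//.
    by apply: archi_boundP; rewrite divr_ge0// ltW.
  by rewrite -natrX ler_nat ltnW// ltn_expl.
have [k kn xk] := dyadic_cover n xt; exists n => //.
exists (dyadic t n k) => //=; rewrite mem_filter; apply/andP; split; last first.
  by apply/mapP; exists k => //; rewrite mem_iota add0n.
apply/asboolP => y /=; rewrite in_itv/= => /andP[ky yk]; apply: eU.
move: xk; rewrite /= in_itv/= => /andP[kx xk].
have kkE : dyadic_pt t n k.+1 = dyadic_pt t n k + t / 2 ^+ n.
  by rewrite /dyadic_pt -natr1; ring.
by rewrite /ball/= ltr_norml; apply/andP; split; lra.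
Qed.

End inner_approximation.

End StieltjesChains.

(** * Density of an absolutely continuous monotone function *)

Section StieltjesDensity.
Context {R : realType} (t : R) (F : cumulative R R).
Hypothesis t0 : 0 <= t.
Hypothesis acF : chain_continuous t F.

Local Notation mu := (@lebesgue_measure R).
Local Notation nu := (lebesgue_stieltjes_measure F).

Let finite_itv : (nu `]0%R, t]%classic < +oo)%E.
Proof. by rewrite lebesgue_stieltjes_itv_oc// ltry. Qed.

Local Notation nut := (@mfrestr _ (measurableTypeR R) R _ nu
  (measurable_itv `]0%R, t]) finite_itv).

(** The chains that exhaust [U] have length at most the Lebesgue measure of [U]. *)
Lemma stieltjes_open_le (U : set R) (d e : R) : open U ->
  (forall s, chain 0 t s -> increments id s < d -> increments F s <= e) ->
  (mu U < d%:E)%E -> (nu (U `&` `]0%R, t]%classic) <= e%:E)%E.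
Proof.
move=> oU H Ud.
have mbig : measurable (\bigcup_n chain_set (inner_grid t U n)).
  by apply: bigcupT_measurable => n; exact: measurable_chain_set.
apply: (@le_trans _ _ (nu (\bigcup_n chain_set (inner_grid t U n)))).
  apply: le_measure; rewrite ?inE//; last exact: inner_grid_cover.
  by apply: measurableI => //; exact: open_measurable.
have C := nondecreasing_cvg_mu (mu := nu)
  (fun n => measurable_chain_set (inner_grid t U n)) mbig
  (inner_grid_nondecreasing U t0).
rewrite -(cvg_lim (@ereal_hausdorff R) C); apply: lime_le.
  by apply/cvg_ex; eexists; exact: C.
apply: nearW => n /=.
have c := chain_inner_grid U t0 n.
rewrite (lebesgue_stieltjes_chain F c) lee_fin; apply: H => //.
rewrite -lte_fin -(lebesgue_stieltjes_chain idfun c).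
apply: le_lt_trans Ud; apply: le_measure; rewrite ?inE//.
- exact: measurable_chain_set.
- exact: open_measurable.
- exact: inner_grid_sub.
Qed.

(** A null set is contained in open sets of arbitrarily small measure. *)
Lemma stieltjes_dominated : nut `<< mu.
Proof.
apply/null_content_dominatesP => A mA A0.
apply/eqP; rewrite eq_le measure_ge0 andbT.
apply/lee_addgt0Pr => e e0; rewrite add0e.
have [d d0 H] := acF e0.
have [|U [oU AU Ud]] := @lebesgue_regularity_outer _ A d mA _ d0.
  by rewrite [ltLHS](_ : _ = 0%E)// A0.
have mU : measurable U by exact: open_measurable.
have {}Ud : (mu U < d%:E)%E.
  rewrite -(setDUK AU) measureU//; last 2 first.
  - exact: measurableD.
  - by rewrite setDIK.
  by rewrite [X in (X + _)%E](_ : _ = 0%E) ?add0e// A0.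
apply: le_trans (stieltjes_open_le oU H Ud).
rewrite /mfrestr /mrestr; apply: le_measure; rewrite ?inE.
- exact: measurableI.
- exact: measurableI.
- exact: setSI.
Qed.

Lemma stieltjes_density : exists2 h : R -> R,
  mu.-integrable [set: R] (EFin \o h) &
  forall x, 0 <= x <= t -> \int[mu]_(y in `]0, x]) h y = F x - F 0.
Proof.
have [h [_ hfin hint hE]] :=
  @radon_nikodym_sigma_finite _ _ _ mu nut stieltjes_dominated.
have hfine : EFin \o (fine \o h) = h.
  by apply/funext => x /=; rewrite fineK.
exists (fine \o h); first by rewrite hfine.
move=> x /andP[x0 xt]; rewrite /Rintegral.
rewrite (eq_integral h) => [|y _ /=]; last by rewrite fineK.
rewrite -hE//.
rewrite [X in fine X](_ : _ = nu `]0%R, x]%classic); last first.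
  rewrite /= /mfrestr /mrestr; congr (nu _); apply: setIidl.
  by apply: subset_itvl; rewrite bnd_simp.
by rewrite lebesgue_stieltjes_itv_oc.
Qed.

End StieltjesDensity.

Section MonotoneDensity.
Context {R : realType} (t : R) (G : R -> R).
Hypothesis t0 : 0 <= t.
Hypothesis Gnd : {in `[0, t] &, nondecreasing_fun G}.
Hypothesis acG : chain_continuous t G.

Let clamp (x : R) := Num.max 0 (Num.min x t).

Let clamp_itv x : clamp x \in `[0, t].
Proof. by rewrite in_itv/= /clamp le_max lexx /= ge_max t0/= ge_min lexx orbT. Qed.

Let clamp_id x : 0 <= x <= t -> clamp x = x.
Proof. by move=> /andP[x0 xt]; rewrite /clamp (min_idPl xt) (max_idPr x0). Qed.

Let le_clamp : {homo clamp : x y / x <= y}.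
Proof.
move=> x y xy; rewrite /clamp ge_max le_max lexx/= le_max; apply/orP; right.
by rewrite le_min !ge_min xy lexx !orbT.
Qed.

Let clampB x y : x <= y -> clamp y - clamp x <= y - x.
Proof.
move=> xy; rewrite /clamp /Num.max /Num.min.
by repeat case: ifPn; rewrite -?leNgt; lra.
Qed.

(** Constant extension outside [[0, t]], to get a cumulative function on the whole
    line. *)
Definition clamped x := G (clamp x).

Lemma clamped_nondecreasing : nondecreasing clamped.
Proof. by move=> x y xy; apply: Gnd => //; exact: le_clamp. Qed.

Lemma clamped_right_continuous : right_continuous clamped.
Proof.
move=> x; apply/cvgrPdist_le => e e0; have [d d0 H] := acG e0.
near=> y; have xy : x <= y by near: y; exact: nbhs_right_ge.
have yd : y < x + d by near: y; apply: nbhs_right_lt; rewrite ltrDl.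
rewrite distrC ger0_norm ?subr_ge0; last exact: clamped_nondecreasing.
have := H [:: (clamp x, clamp y)]; rewrite /increments !big_seq1 /=; apply.
  move: (clamp_itv x) (clamp_itv y) (le_clamp xy).
  by rewrite !in_itv/= => /andP[-> _] /andP[_ ->] ->.
by apply: le_lt_trans (clampB xy) _; rewrite ltrBlDl.
Unshelve. all: by end_near. Qed.

HB.instance Definition _ :=
  isCumulative.Build R _ R clamped clamped_nondecreasing clamped_right_continuous.

Lemma monotone_density : exists2 h : R -> R,
  (@lebesgue_measure R).-integrable [set: R] (EFin \o h) &
  forall x, 0 <= x <= t ->
    \int[@lebesgue_measure R]_(y in `]0, x]) h y = G x - G 0.
Proof.
have ac : chain_continuous t (clamped : cumulative R R).
  move=> e e0; have [d d0 H] := acG e0; exists d => // s cs sd.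
  rewrite (_ : increments _ s = increments G s); first exact: H.
  rewrite /increments !big_seq; apply: eq_bigr => p ps.
  have [i si] := nthP 0 ps => <-; have [h1 h2 h3] := chain_nth cs si.
  rewrite /= /clamped !clamp_id//.
  - by rewrite h1 (le_trans h2).
  - by rewrite h3 (le_trans h1).
have [h hi hE] := stieltjes_density t0 ac.
by exists h => // x xt; rewrite hE//= /clamped !clamp_id// lexx t0.
Qed.

End MonotoneDensity.

(** * Fundamental theorem of calculus for absolutely continuous functions *)

Section AC.
Context {R : realType}.
Implicit Types (t x : R) (f h : R -> R).
Local Notation mu := (@lebesgue_measure R).

Lemma nondecreasing_tv_upto t f : bounded_variation 0 t f ->
  {in `[0, t] &, nondecreasing_fun (tv_upto f)}.
Proof.
move=> bf x y; rewrite !in_itv/= => /andP[x0 xt] /andP[y0 yt] xy.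
by rewrite -subr_ge0 (le_trans _ (le_tv_upto bf x0 xy yt)).
Qed.

Lemma nondecreasing_tv_uptoB t f : bounded_variation 0 t f ->
  {in `[0, t] &, nondecreasing_fun (fun x => tv_upto f x - f x)}.
Proof.
move=> bf x y; rewrite !in_itv/= => /andP[x0 xt] /andP[y0 yt] xy.
have := le_trans (ler_norm _) (le_tv_upto bf x0 xy yt); lra.
Qed.

(** With [V] the total variation of [f], both [V] and [V - f] are nondecreasing
    and absolutely continuous, and [f = V - (V - f)]. *)
Lemma abs_continuous_density t f : 0 <= t -> abs_continuous 0 t f ->
  exists2 h : R -> R, mu.-integrable [set: R] (EFin \o h) &
  forall x, 0 <= x <= t -> \int[mu]_(y in `]0, x]) h y = f x - f 0.
Proof.
move=> t0 acf; have bf := abs_continuous_bounded_variation t0 acf.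
have acV := chain_continuous_tv_upto t0 acf.
have [h1 i1 E1] := monotone_density t0 (nondecreasing_tv_upto bf) acV.
have [h2 i2 E2] : exists2 h : R -> R, mu.-integrable [set: R] (EFin \o h) &
    forall x, 0 <= x <= t -> \int[mu]_(y in `]0, x]) h y =
      (tv_upto f x - f x) - (tv_upto f 0 - f 0).
  apply: monotone_density => //; first exact: nondecreasing_tv_uptoB.
  move=> e e0; have e20 : 0 < e / 2 by rewrite divr_gt0.
  have [d1 d10 H1] := acV _ e20; have [d2 d20 H2] := abs_continuous_chain acf e20.
  exists (Num.min d1 d2) => [|s cs]; first by rewrite lt_min d10.
  rewrite lt_min => /andP[/(H1 _ cs) s1 /(H2 _ cs) s2].
  have -> : increments (fun x => tv_upto f x - f x) s =
      increments (tv_upto f) s - \sum_(p <- s) (f p.2 - f p.1).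
    by rewrite /increments -sumrB; apply: eq_bigr => p _; lra.
  have : - \sum_(p <- s) (f p.2 - f p.1) <= abs_increments f s.
    by rewrite (le_trans (ler_norm _))// normrN; exact: ler_norm_sum.
  lra.
exists (fun y => h1 y - h2 y).
  rewrite (_ : _ \o _ = (EFin \o h1) \- (EFin \o h2))%E//; exact: integrableB.
move=> x xt; rewrite RintegralB//; last 2 first.
- exact: integrableS i1.
- exact: integrableS i2.
by rewrite E1// E2//; lra.
Qed.

Lemma density_derivable t f h : mu.-integrable [set: R] (EFin \o h) ->
  (forall x, 0 <= x <= t -> \int[mu]_(y in `]0, x]) h y = f x - f 0) ->
  {ae mu, forall x, 0 < x < t -> derivable f x 1 /\ derive1 f x = h x}.
Proof.
move=> ih hE.
have loc : locally_integrable [set: R] h.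
  by apply: open_integrable_locally => //; exact: openT.
have ii y : mu.-integrable [set` Interval (BRight 0) (BRight y)] (EFin \o h).
  exact: integrableS ih.
have := FTC1 ii loc.
apply: filterS; first exact: (ae_filter_ringOfSetsType mu).
move=> x /= H /andP[x0 xt].
have [] := H x0.
set F := fun x => _ => dF FE.
have FfE y : 0 <= y <= t -> F y + f 0 = f y by move=> yt; rewrite /F hE ?subrK.
clearbody F.
have nF : {near x, (fun y => F y + f 0) =1 f}.
  near=> y; rewrite FfE//; apply/andP; split.
    by apply/ltW; near: y; exact: lt_nbhsr.
  by apply/ltW; near: y; exact: lt_nbhsl.
have dc : derivable (fun=> f 0) x 1 := derivable_cst _ _ _.
split; first exact: near_eq_derivable (derivableD dF dc).
rewrite derive1E -(near_eq_derive _ nF) (deriveD dF dc) derive_cst addr0.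
by rewrite -derive1E.
Unshelve. all: by end_near. Qed.

(** Differentiability is asked at the minimum alone because the coordinates of a
    control path are differentiable only almost everywhere. *)
Lemma derive1_local_min f (c e : R) : 0 < e -> derivable f c 1 ->
  (forall y, `|y - c| < e -> f c <= f y) -> derive1 f c = 0.
Proof.
move=> e0 df fmin; rewrite derive1E; apply/eqP; apply: contraT => l0.
have : h^-1 *: ((f \o shift c) (h *: 1) - f c) @[h --> 0^'] --> 'D_1 f c := df.
set l := 'D_1 f c in l0 * => /cvgrPdist_lt/(_ `|l|).
rewrite normr_gt0 => /(_ l0) [d /= d0 H].
pose m := Num.min d e / 2.
have m0 : 0 < m by rewrite divr_gt0// lt_min d0.
have md : m < d by have := ge_min d d e; rewrite lexx /= /m => ?; lra.
have me : m < e by have := ge_min e d e; rewrite lexx orbT /= /m => ?; lra.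
have Hm s : `|s| = m -> `|l - s^-1 * (f (s + c) - f c)| < `|l| /\ f c <= f (s + c).
  move=> sm; split; last by apply: fmin; rewrite addrK sm.
  have := H s; rewrite /= sub0r normrN sm md => /(_ isT).
  rewrite -normr_gt0 sm m0 => /(_ isT).
  by rewrite /GRing.scale/= mulr1.
have [ln|lp|l00] := ltgtP l 0; last by rewrite l00 eqxx in l0.
  have [|H1 H2] := Hm m; first by rewrite gtr0_norm.
  move: H1; rewrite (ltr0_norm ln) ltr_norml => /andP[H1 _].
  have : 0 <= m^-1 * (f (m + c) - f c).
    by rewrite mulr_ge0 ?invr_ge0 ?subr_ge0// ltW.
  by move: H1; lra.
have [|H1 H2] := Hm (- m); first by rewrite normrN gtr0_norm.
move: H1; rewrite (gtr0_norm lp) ltr_norml => /andP[_ H1].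
have : 0 <= m^-1 * (f (- m + c) - f c).
  by rewrite mulr_ge0 ?invr_ge0 ?subr_ge0// ltW.
by move: H1; rewrite invrN mulNr; lra.
Qed.

Lemma ae_and (P Q : set R) :
  {ae mu, forall x, P x} -> {ae mu, forall x, Q x} ->
  {ae mu, forall x, P x /\ Q x}.
Proof. exact: (@filterI _ _ (ae_filter_ringOfSetsType mu)). Qed.

(** The positive and the negative parts are compared separately, so that the
    integrals may be infinite, as the cost of a control triplet may be. *)
Lemma ae_le_integral (D : set R) (f g : R -> \bar R) : measurable D ->
  measurable_fun D f -> measurable_fun D g ->
  {ae mu, forall x, D x -> (f x <= g x)%E} ->
  (\int[mu]_(x in D) f x <= \int[mu]_(x in D) g x)%E.
Proof.
move=> mD mf mg fg; rewrite integralE [leRHS]integralE leeB//.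
- apply: ae_ge0_le_integral => //; [exact: measurable_funepos..|].
  move: fg; apply: filterS; first exact: (ae_filter_ringOfSetsType mu).
  move=> x fg /fg fgx; rewrite !funeposE.
  by rewrite ge_max !le_max fgx lexx orbT.
- apply: ae_ge0_le_integral => //; [exact: measurable_funeneg..|].
  move: fg; apply: filterS; first exact: (ae_filter_ringOfSetsType mu).
  move=> x fg /fg fgx; rewrite !funenegE.
  by rewrite ge_max !le_max leeN2 fgx lexx orbT.
Qed.

End AC.

(** * Affine lower bounds for the cost *)

Section Calibration.
Context {R : realType}.
Implicit Types (a b c p r t : R) (x : R * R) (u : triplet R).
Local Notation mu := (@lebesgue_measure R).

(** Maximum over the relative speed [z] of [p (z - b) - z^2 / (4 a)]: what a unit
    of reflection gains at horizontal slope [p]. *)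
Definition road_gain a b p := a * p ^+ 2 - b * p.

(** The slopes for which [calibration] is a subsolution both in the field and on
    the road. *)
Definition admissible a b p r := 0 <= r /\ road_gain a b p <= r.

(** Linear in [(x, t)] and zero at the origin, hence a lower bound of the action
    as soon as it is a subsolution; [1 + p^2 + r^2] is the value of the field
    Hamiltonian, in the frame moving with [c], at its gradient [(- p, r)]. *)
Definition calibration c p r x t :=
  - p * (x.1 - c * t) + r * x.2 - t * (1 + p ^+ 2 + r ^+ 2).

Lemma LagrE c (e : R * R) :
  Lagr c (- e) = ((e.1 + c) / 2) ^+ 2 + (e.2 / 2) ^+ 2 - 1.
Proof. by rewrite /Lagr /=; field. Qed.

(** Fenchel inequality for the quadratic Lagrangian. *)
Lemma field_cost_ge c p r (e : R * R) :
  p * (e.1 + c) - r * e.2 - (1 + p ^+ 2 + r ^+ 2) <= Lagr c (- e).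
Proof.
rewrite LagrE -subr_ge0.
rewrite (_ : _ - _ = ((e.1 + c) / 2 - p) ^+ 2 + (e.2 / 2 + r) ^+ 2); last by field.
by rewrite addr_ge0 ?sqr_ge0.
Qed.

(** On the road the vertical slope acts only through the reflection rate [l]:
    after minimizing over the relative speed [z], the remaining terms
    [l^2 / 4 - l r + r^2] form a square. *)
Lemma road_cost_ge a b c p r (e : R * R) (v l : R) : 0 < a ->
  admissible a b p r -> 0 < l -> e.2 = - l ->
  p * (v + c) - (1 + p ^+ 2 + r ^+ 2) <=
  Lagr c (- e) + l * Gcost a b ((e.1 - v) / l).
Proof.
move=> a0 [r0 gr] l0 el; rewrite LagrE el /Gcost.
set z := (e.1 - v) / l; have -> : v = e.1 - l * z.
  by rewrite /z mulrC divfK ?gt_eqF// subKr.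
have zE : (z - b) ^+ 2 / (4 * a) + p * z + road_gain a b p =
    a * ((z - b) / (2 * a) + p) ^+ 2.
  by rewrite /road_gain; field; rewrite gt_eqF.
have z0 : 0 <= (z - b) ^+ 2 / (4 * a) + p * z + r.
  apply: (@le_trans _ _ (a * ((z - b) / (2 * a) + p) ^+ 2)).
    by rewrite mulr_ge0 ?sqr_ge0 ?ltW.
  by rewrite -zE lerD2l.
rewrite -subr_ge0 (_ : _ - _ = ((e.1 + c) / 2 - p) ^+ 2 + (l / 2 - r) ^+ 2 +
  l * ((z - b) ^+ 2 / (4 * a) + p * z + r)); last by field; rewrite gt_eqF.
by rewrite !addr_ge0 ?sqr_ge0// mulr_ge0// ltW.
Qed.

Lemma measurable_running_cost a b c x t u : control_triplet a b x t u ->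
  measurable_fun `[0, t] (fun s => Lagr c (- (eta u s)) + Fcost a b u s).
Proof.
move=> ct.
have m1 : measurable_fun `[0, t] (fun s => (eta u s).1).
  by apply/measurable_EFinP; exact: measurable_int (ct_eta1 ct).
have m2 : measurable_fun `[0, t] (fun s => (eta u s).2).
  by apply/measurable_EFinP; exact: measurable_int (ct_eta2 ct).
have mF : measurable_fun `[0, t] (Fcost a b u).
  by apply/measurable_EFinP; exact: measurable_int (ct_Fcost ct).
apply: measurable_funD => //.
rewrite (_ : (fun s => Lagr c (- eta u s)) = (fun s =>
    (((eta u s).1 + c) / 2) ^+ 2 + ((eta u s).2 / 2) ^+ 2 - 1)); last first.
  by apply/funext => s; exact: LagrE.
apply: measurable_funB => //; apply: measurable_funD.
- apply: measurable_funX; apply: measurable_funM => //.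
  exact: measurable_funD.
- by apply: measurable_funX; apply: measurable_funM.
Qed.

(** At almost every time on the road the vertical speed vanishes, because
    [gamma_2] is minimal there; so one of the two pointwise bounds applies at
    almost every time. *)
Lemma calibration_le_cost a b c p r x t u : 0 < a -> 0 <= t -> admissible a b p r ->
  bridge a b x t u -> ((calibration c p r x t)%:E <= cost a b c u t)%E.
Proof.
move=> a0 t0 pr [ct ut].
have [h1 i1 E1] := abs_continuous_density t0 (ct_ac1 ct).
have [h2 i2 E2] := abs_continuous_density t0 (ct_ac2 ct).
have D1 := density_derivable i1 E1; have D2 := density_derivable i2 E2.
pose k := p * c - (1 + p ^+ 2 + r ^+ 2).
pose m s := p * h1 s - r * h2 s + k.
have I1 : mu.-integrable `]0, t] (EFin \o h1) by exact: integrableS i1.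
have I2 : mu.-integrable `]0, t] (EFin \o h2) by exact: integrableS i2.
have pI1 : mu.-integrable `]0, t] (EFin \o (fun s => p * h1 s)).
  by have := integrableZl _ p I1; apply.
have rI2 : mu.-integrable `]0, t] (EFin \o (fun s => r * h2 s)).
  by have := integrableZl _ r I2; apply.
have finoc : (mu `]0%R, t]%classic < +oo)%E.
  by rewrite lebesgue_measure_itv /=; case: ifP => _; rewrite ltry.
have mut : fine (mu `]0%R, t]%classic) = t.
  rewrite lebesgue_measure_itv /= lte_fin; have [t1|t1] := ltP 0 t.
    by rewrite /= subr0.
  by apply/eqP; rewrite eq_le t0 t1.
have Ik : mu.-integrable `]0, t] (EFin \o (fun=> k)).
  apply: measurable_bounded_integrable => //.
  by exists `|k|; split; [exact: num_real|move=> y ky s _; exact: ltW].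
have I12 : mu.-integrable `]0, t] (EFin \o (fun s => p * h1 s - r * h2 s)).
  by have := integrableB _ pI1 rI2; apply.
have Im : mu.-integrable `]0, t] (EFin \o m).
  by have := integrableD _ I12 Ik; apply.
have -> : calibration c p r x t = \int[mu]_(s in `]0, t]) m s.
  rewrite RintegralD// RintegralB// !RintegralZl// E1 ?E2 ?t0 ?lexx//.
  rewrite (ct_start ct) ut Rintegral_cst// [fine _]mut.
  by rewrite /= /calibration /k; ring.
rewrite /Rintegral fineK; last exact: integrable_fin_num.
have mm : measurable_fun [set: R] m.
  have mh1 : measurable_fun [set: R] h1.
    by apply/measurable_EFinP; exact: measurable_int i1.
  have mh2 : measurable_fun [set: R] h2.
    by apply/measurable_EFinP; exact: measurable_int i2.
  by apply: measurable_funD => //; apply: measurable_funB => //; apply: measurable_funM.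
rewrite integral_itv_obnd_cbnd; last first.
  by apply/measurable_EFinP; exact: measurable_funTS.
rewrite /cost; apply: ae_le_integral => //.
- by apply/measurable_EFinP; exact: measurable_funTS.
- by apply/measurable_EFinP; exact: measurable_running_cost ct.
have ne s0 : {ae mu, forall s : R, s != s0}.
  exists [set s0]; split => //; first exact: lebesgue_measure_set1.
  by move=> s /= /negP; rewrite negbK => /eqP.
have := ae_and (ae_and (ae_and D1 D2) (ae_and (ct_refl ct) (ct_dyn ct)))
  (ae_and (ne 0) (ne t)).
apply: filterS; first exact: (ae_filter_ringOfSetsType mu).
move=> s /= [[[H1 H2] [H3 H4]] [s0 st]] /[dup] + s0t.
rewrite in_itv/= => /andP[s0' st'].
have {s0 s0'}s0 : 0 < s by rewrite lt_neqAle eq_sym s0.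
have {st st'}st : s < t by rewrite lt_neqAle st.
have [_ e1] := H1 (introT andP (conj s0 st)).
have [d2 e2] := H2 (introT andP (conj s0 st)).
have [l0 lg] := H3 s0t; have [dl0 dl] := H4 s0t.
have {}e1 : dgam1 u s = h1 s := e1.
have {}e2 : dgam2 u s = h2 s := e2.
rewrite lee_fin /Fcost /m /k; case: ifPn => [l_gt0|]; last first.
  rewrite -leNgt => l_le0; have l_eq0 : ell u s = 0.
    by apply/eqP; rewrite eq_le l_le0 l0.
  have etaE : eta u s = (h1 s, h2 s) by rewrite -(dl0 l_eq0) e1 e2.
  rewrite addr0 (le_trans _ (field_cost_ge c p r (eta u s)))// etaE /=; clear; lra.
have l_neq0 : ell u s != 0 by rewrite gt_eqF.
have g0 : (gam u s).2 = 0 by apply/eqP; apply: contraNT l_neq0 => /lg/eqP.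
(* the path touches the road at the interior time [s] *)
have h20 : h2 s = 0.
  have mn0 : 0 < Num.min s (t - s) by rewrite lt_min s0 subr_gt0.
  rewrite -e2; apply: (derive1_local_min mn0 d2).
  move=> y; rewrite lt_min !ltr_norml => /andP[/andP[y1 _] /andP[_ y2]].
  rewrite g0; apply: (ct_half_plane ct); rewrite in_itv/=.
  by clear - y1 y2; apply/andP; split; lra.
have eta2 : (eta u s).2 = - ell u s by rewrite dl// e2 h20 sub0r.
have H := road_cost_ge c (h1 s) a0 pr l_gt0 eta2.
rewrite e1; apply: le_trans H.
by rewrite h20 mulr0; clear; lra.
Qed.

End Calibration.

(** * Paths with one kink and step functions *)

Section Steering.
Context {R : realType}.
Implicit Types (r s t k : R).
Local Notation mu := (@lebesgue_measure R).

Lemma lipschitz_abs_continuous (lo hi K : R) (f : R -> R) : 0 <= K ->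
  (forall x y, lo <= x -> x <= y -> y <= hi -> `|f y - f x| <= K * (y - x)) ->
  abs_continuous lo hi f.
Proof.
move=> K0 lip e e0; have K1 : 0 < K + 1 by rewrite ltr_wpDl.
exists (e / (K + 1)); first by rewrite divr_gt0.
move=> n u v uv _; rewrite ltr_pdivlMr// => sd; apply: le_lt_trans sd.
rewrite mulr_suml; apply: ler_sum => i _; have [h1 h2 h3] := uv i (ltn_ord i).
by rewrite (le_trans (lip _ _ h1 h2 h3))// mulrC ler_wpM2l ?subr_ge0// lerDl.
Qed.

(** Velocity [B] before time [s] and [B + C] after it, plus a perturbation
    of size [D] vanishing at times [0] and [t]. *)
Definition kinked (x B C D s t : R) r :=
  x + B * r + C * Num.max (r - s) 0 + D * (r * (t - r)).

Lemma kinked_abs_continuous x B C D s t : 0 <= t ->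
  abs_continuous 0 t (kinked x B C D s t).
Proof.
move=> t0; apply: (@lipschitz_abs_continuous _ _ (`|B| + `|C| + `|D| * t)).
  by rewrite !addr_ge0 ?mulr_ge0.
move=> y z y0 yz zt; rewrite /kinked.
set mz := Num.max (z - s) 0; set my := Num.max (y - s) 0.
have -> : x + B * z + C * mz + D * (z * (t - z)) -
    (x + B * y + C * my + D * (y * (t - y))) =
    B * (z - y) + C * (mz - my) + D * (z - y) * (t - y - z) by ring.
have m0 : 0 <= mz - my <= z - y.
  by rewrite /mz /my /Num.max; do 2 case: ifPn; rewrite -?leNgt; lra.
have zy : `|z - y| = z - y by rewrite ger0_norm// subr_ge0.
rewrite (le_trans (ler_normD _ _))// !mulrDl; apply: lerD.
  rewrite (le_trans (ler_normD _ _))//; apply: lerD; first by rewrite normrM zy.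
  rewrite normrM ler_wpM2l// ger0_norm; first by case/andP: m0.
  by case/andP: m0.
rewrite !normrM zy -!mulrA ler_wpM2l// mulrC ler_wpM2r ?subr_ge0//.
by rewrite ler_norml; apply/andP; split; lra.
Qed.

Lemma kinked_derive1 x B C D s t r : r != s ->
  derive1 (kinked x B C D s t) r =
  B + (if s < r then C else 0) + D * (t - 2 * r).
Proof.
move=> rs; pose k := if s < r then C else 0.
pose P : {poly R} := x%:P + B%:P * 'X + k%:P * ('X - s%:P) + D%:P * ('X * (t%:P - 'X)).
have nP : {near r, horner P =1 kinked x B C D s t}.
  have [rs'|sr|rE] := ltgtP r s; last by rewrite rE eqxx in rs.
  - have : \forall y \near r, y < s by exact: lt_nbhsl.
    apply: filterS => y ys; rewrite /P /k (lt_gtF rs') /kinked max_r ?subr_le0 1?ltW//.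
    by rewrite !hornerE; ring.
  - have : \forall y \near r, s < y by exact: lt_nbhsr.
    apply: filterS => y ys; rewrite /P /k sr /kinked max_l ?subr_ge0 1?ltW//.
    by rewrite !hornerE; ring.
rewrite derive1E -(near_eq_derive _ nP) derive_val /P -/k !poly.derivE !hornerE.
ring.
Qed.

Lemma horner_FTC (p : {poly R}) r : 0 <= r ->
  (\int[mu]_(y in `[0%R, r]) (p^`()%R.[y])%:E = (p.[r] - p.[0])%:E)%E.
Proof.
rewrite le_eqVlt => /predU1P[<-|r0].
  by rewrite set_itv1 integral_set1 subrr.
rewrite (@continuous_FTC2 _ _ (horner p))//.
- by apply: continuous_subspaceT => y; exact: continuous_horner.
- split.
  + by move=> y _; exact: ex_derive.
  + by apply: cvg_at_right_filter; exact: continuous_horner.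
  + by apply: cvg_at_left_filter; exact: continuous_horner.
- by move=> y _; rewrite derive1E derive_val.
Qed.

Definition step_after s k : R -> R := fun r => if s < r then k else 0.

Lemma step_afterE s k : step_after s k = (cst k) \_ `]s, +oo[%classic.
Proof.
apply/funext => r; rewrite patchE /step_after.
by rewrite (_ : (r \in `]s, +oo[%classic) = (s < r)) // mem_setE in_itv/= andbT.
Qed.

Lemma measurable_step_after s k : measurable_fun [set: R] (step_after s k).
Proof. by rewrite step_afterE; apply/(measurable_restrictT _ _).1 => //. Qed.

Lemma integrable_step_after s k (t : R) : mu.-integrable `[0, t] (EFin \o step_after s k).
Proof.
have fin : (mu `[0%R, t]%classic < +oo)%E.
  by rewrite lebesgue_measure_itv/=; case: ifP => _; rewrite ltry.
apply: measurable_bounded_integrable => //.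
- by apply: measurable_funTS; exact: measurable_step_after.
- exists `|k|; split; first exact: num_real.
  move=> y ky r _ /=; rewrite /step_after; case: (s < r); first exact: ltW.
  by rewrite normr0 (le_trans _ (ltW ky)).
Qed.

Lemma integral_step_after s k r : 0 <= s -> 0 <= r ->
  (\int[mu]_(y in `[0%R, r]) (step_after s k y)%:E = (k * Num.max (r - s) 0)%:E)%E.
Proof.
move=> s0 r0; rewrite step_afterE.
transitivity (\int[mu]_(y in `[0%R, r])
    ((fun=> k%:E) \_ `]s, +oo[%classic) y)%E.
  by apply: eq_integral => y _; rewrite !patchE; case: ifP.
rewrite -integral_mkcondr.
have -> : `[0%R, r]%classic `&` `]s, +oo[%classic = `]s, r]%classic.
  apply/seteqP; split => y /=; rewrite !in_itv/= andbT.
    by move=> [/andP[_ ->] ->].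
  by move=> /andP[sy ->]; rewrite sy (le_trans s0 (ltW sy)).
rewrite integral_cst// [X in (_ * X)%E]lebesgue_measure_itv/= lte_fin.
case: ltP => sr; first by rewrite max_l ?subr_ge0 1?ltW// -EFinB -EFinM.
by rewrite max_r ?subr_le0// mulr0 mule0.
Qed.

End Steering.

(** * Explicit control triplets *)

Section Steer.
Context {R : realType}.
Implicit Types (a b c p r s t k : R) (x B C D : R * R).
Local Notation mu := (@lebesgue_measure R).

(** The perturbation [D] enters the path and [eta] alike, so it does not change
    [eta - gamma'] and leaves the road cost constant. *)
Definition steer x B C D s t : triplet R := Triplet
  (fun r => (kinked x.1 B.1 C.1 D.1 s t r, kinked x.2 B.2 C.2 D.2 s t r))
  (fun r => (B.1 + D.1 * (t - 2 * r), B.2 + D.2 * (t - 2 * r)))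
  (step_after s C.2).

(** Either there is no reflection at all ([C = 0]), or the path hits the road at
    time [s] with normal velocity [- C.2] and is kept there by the reflection
    rate [C.2], which forbids a vertical perturbation. *)
Definition steerable x B C D s t :=
  [/\ 0 <= s <= t, x.1 + B.1 * t + C.1 * (t - s) = 0,
      x.2 + B.2 * t + C.2 * (t - s) = 0,
      C = 0 \/ [/\ 0 < C.2, D.2 = 0, B.2 = - C.2 & x.2 = C.2 * s] &
      forall r, 0 <= r <= t -> 0 <= kinked x.2 B.2 C.2 D.2 s t r].

Definition road_cost a b C :=
  if 0 < C.2 then C.2 * Gcost a b (- C.1 / C.2) else 0.

Lemma Fcost_steer a b x B C D s t :
  Fcost a b (steer x B C D s t) = step_after s (road_cost a b C).
Proof.
apply/funext => r; rewrite /Fcost /= /step_after /road_cost.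
case: (boolP (s < r)) => sr; last by rewrite ltxx.
case: ifPn => // C0; rewrite /dgam1 /= kinked_derive1 ?gt_eqF// sr.
by congr (_ * Gcost _ _ (_ / _)); ring.
Qed.

Lemma horner_integrable (P : {poly R}) t :
  mu.-integrable `[0, t] (EFin \o horner P).
Proof.
apply: continuous_compact_integrable; first exact: segment_compact.
by apply: continuous_subspaceT => y; exact: continuous_horner.
Qed.

Lemma steer_bridge a b x B C D s t : steerable x B C D s t ->
  bridge a b x t (steer x B C D s t).
Proof.
move=> [/andP[s0 st] e1 e2 road half]; have t0 := le_trans s0 st.
have ts : Num.max (t - s) 0 = t - s by rewrite max_l// subr_ge0.
have affint (u v : R) : mu.-integrable `[0, t]
    (fun r => (u + v * (t - 2 * r))%:E).
  have := horner_integrable (u%:P + v%:P * (t%:P - 2%:P * 'X)) t.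
  by congr (mu.-integrable _ _); apply/funext => r; rewrite /= !hornerE.
have ne : {ae mu, forall r : R, r != s}.
  exists [set s]; split => //; first exact: lebesgue_measure_set1.
  by move=> r /= /negP; rewrite negbK => /eqP.
split; last by rewrite /= /kinked ts subrr !mulr0 !addr0 e1 e2.
split.
- exact: kinked_abs_continuous.
- exact: kinked_abs_continuous.
- by move=> r; rewrite in_itv/=; exact: half.
- exact: affint.
- exact: affint.
- exact: integrable_step_after.
- rewrite /= /kinked sub0r max_r ?oppr_le0// !mulr0 mul0r !mulr0 !addr0.
  by case: (x).
- move: ne; apply: filterS; first exact: (ae_filter_ringOfSetsType mu).
  move=> r /= rs rt; rewrite /step_after; case: ifPn => [sr|//].
  case: road => [->|[C0 D0 BC x2]]; first by rewrite /= lexx.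
  split; first exact: ltW.
  move=> /eqP; case; rewrite /kinked D0 BC x2 max_l; last by rewrite subr_ge0 ltW.
  ring.
- rewrite Fcost_steer; exact: integrable_step_after.
- move: ne; apply: filterS; first exact: (ae_filter_ringOfSetsType mu).
  move=> r /= rs rt; rewrite /dgam1 /dgam2 /= !kinked_derive1// /step_after.
  case: road => [->|[C0 D0 BC x2]].
    by rewrite /= !if_same eqxx !addr0.
  case: ifPn => sr; last by rewrite !addr0 eqxx.
  split=> [/eqP|_]; first by rewrite gt_eqF.
  by rewrite D0 BC; ring.
Qed.

(** The coefficient [24] comes from the integral of [(t - 2 y)^2 / 4], which is
    [(t^3 - (t - 2 r)^3) / 24] over [[0, r]]. *)
Lemma cost_steer a b c x B C D s t r : 0 <= s -> 0 <= r ->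
  cost a b c (steer x B C D s t) r =
  (r * (((B.1 + c) / 2) ^+ 2 + (B.2 / 2) ^+ 2 - 1) +
   ((B.1 + c) * D.1 + B.2 * D.2) / 2 * (r * (t - r)) +
   (D.1 ^+ 2 + D.2 ^+ 2) / 24 * (t ^+ 3 - (t - 2 * r) ^+ 3) +
   road_cost a b C * Num.max (r - s) 0)%:E.
Proof.
move=> s0 r0; rewrite /cost Fcost_steer.
set k1 := (_ + _ - 1); set k2 := (_ + _) / 2; set k3 := (_ + _) / 24.
pose P : {poly R} := k1%:P * 'X + k2%:P * ('X * (t%:P - 'X))
  + k3%:P * ((t ^+ 3)%:P - (t%:P - 2%:P * 'X) ^+ 3).
have -> : (fun y => (Lagr c (- eta (steer x B C D s t) y) +
    step_after s (road_cost a b C) y)%:E) =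
    (EFin \o horner P^`()%R) \+ (EFin \o step_after s (road_cost a b C)).
  apply/funext => y /=; congr (_%:E); congr (_ + _).
  rewrite (LagrE c (B.1 + D.1 * (t - 2 * y), B.2 + D.2 * (t - 2 * y))) /=.
  by rewrite /P /k1 /k2 /k3 !poly.derivE !hornerE /=; field.
rewrite integralD//; last 2 first.
- exact: horner_integrable.
- exact: integrable_step_after.
rewrite [X in (X + _)%E](horner_FTC P r0) [X in (_ + X)%E]integral_step_after// -EFinD.
congr (_%:E); congr (_ + _).
by rewrite /P !hornerE /=; ring.
Qed.

End Steer.

(** * Optimal triplets *)

Section Optimal.
Context {R : realType}.
Implicit Types (a b c p r s t k sg : R) (x B C D : R * R).
Local Notation mu := (@lebesgue_measure R).

(** Stationarity in [p] of the best calibration at [(x, t)], where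
    [X = x_1 - c t] and [sg = x_2 / (2 t)]: for fixed [p] the best [r] is the larger of
    [road_gain p] and [sg].  For large [|p|] the factor [2 a p - b] has the sign of
    [p], whence the sign change. *)
Lemma critical_slope a b t X sg : 0 < a -> 0 < t -> exists p,
  X + 2 * t * p + 2 * t * Num.max (road_gain a b p - sg) 0 * (2 * a * p - b) = 0.
Proof.
move=> a0 t0.
pose f p := X + 2 * t * p + 2 * t * Num.max (road_gain a b p - sg) 0 * (2 * a * p - b).
pose M := `|X| / (2 * t) + `|b| / (2 * a).
have M0 : 0 <= M by rewrite addr_ge0 ?divr_ge0 ?mulr_ge0// ltW.
have tM : `|X| <= 2 * t * M.
  rewrite /M mulrDr mulrCA divff ?mulr1; last by rewrite gt_eqF// mulr_gt0.
  by rewrite lerDl mulr_ge0 ?divr_ge0 ?mulr_ge0// ltW.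
have aM : `|b| <= 2 * a * M.
  rewrite /M mulrDr [in X in _ + X]mulrCA divff ?mulr1; last by rewrite gt_eqF// mulr_gt0.
  by rewrite lerDr mulr_ge0 ?divr_ge0 ?mulr_ge0// ltW.
have max0 y : 0 <= 2 * t * Num.max y 0 :> R.
  by apply: mulr_ge0; [rewrite mulr_ge0// ltW|rewrite le_max lexx orbT].
have cf : continuous f.
  (* as a combination of polynomials and one maximum, whose continuity is known *)
  have E : f = horner (X%:P + (2 * t)%:P * 'X) \+
     (2 * t) \*: ((horner (a%:P * 'X ^+ 2 - b%:P * 'X - sg%:P) \max cst 0) \*
        horner ((2 * a)%:P * 'X - b%:P)).
    apply/funext => p; rewrite /f /= /GRing.scale /= !hornerE /=.
    by rewrite /Order.max_fun /road_gain mulrA.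
  rewrite E => p; apply: cvgD; first exact: continuous_horner.
  apply: cvgZr; apply: cvgM; last exact: continuous_horner.
  apply: continuous_max; last exact: cst_continuous.
  exact: continuous_horner.
have [|||p _ fp] := @IVT R f (- M) M 0.
- by rewrite ge0_cp.
- exact: continuous_subspaceT.
- rewrite ge_min le_max; apply/andP; split; apply/orP; [left|right].
  + rewrite /f -[leRHS]addr0; apply: lerD.
      by have := le_trans (ler_norm X) tM; lra.
    rewrite mulr_ge0_le0//; have := le_trans (ler_norm (- b)) _.
    by rewrite normrN => /(_ _ aM); lra.
  + rewrite /f addr_ge0//.
      by have := ler_norm (- X); rewrite normrN; lra.
    by rewrite mulr_ge0//; have := ler_norm b; lra.
by exists p.
Qed.

(** The triplet [w 0] attains the calibration of [(p, r)] without ever exceeding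
    its positive part; the perturbations [w d] have cost larger by [k d^2] and,
    when the calibration vanishes, run through points where it is positive. *)
Definition optimal_family a b c x t p r (w : R -> triplet R) (k : R) :=
  [/\ admissible a b p r,
      forall d, 0 <= d -> bridge a b x t (w d),
      forall s, 0 <= s <= t ->
        (cost a b c (w 0%R) s <= (Num.max 0 (calibration c p r x t))%R%:E)%E,
      forall d, cost a b c (w d) t = (calibration c p r x t + k * d ^+ 2)%:E &
      calibration c p r x t = 0 -> forall d s, 0 < d -> 0 < s < t ->
        0 < calibration c p r (gam (w d) s) (t - s)].

(** The segment to the origin, at the constant running cost [p^2 + sg^2 - 1]. *)
Lemma optimal_field a b c x t : half_plane x -> 0 < t ->
  let p := - (x.1 - c * t) / (2 * t) in
  let sg := x.2 / (2 * t) in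
  road_gain a b p <= sg ->
  exists w k, optimal_family a b c x t p sg w k.
Proof.
move=> x2 t0 p sg Gp.
have t_neq0 : t != 0 by rewrite gt_eqF.
have x1E : x.1 = c * t - 2 * t * p by rewrite /p; field.
have x2E : x.2 = 2 * t * sg by rewrite /sg; field.
have sg0 : 0 <= sg by rewrite divr_ge0// mulr_ge0// ltW.
clearbody p sg.
pose w d := steer x (2 * p - c, - (2 * sg)) 0 (- (d * p), d * sg) t t.
have cal : calibration c p sg x t = t * (p ^+ 2 + sg ^+ 2 - 1).
  by rewrite /calibration x1E x2E; ring.
have costE d s : 0 <= s -> s <= t -> cost a b c (w d) s =
    (s * (p ^+ 2 + sg ^+ 2 - 1) - d * (p ^+ 2 + sg ^+ 2) * (s * (t - s)) +
    (p ^+ 2 + sg ^+ 2) / 24 * (t ^+ 3 - (t - 2 * s) ^+ 3) * d ^+ 2)%:E.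
  move=> s0 st; rewrite cost_steer ?(ltW t0)// max_r ?subr_le0//=.
  by congr (_%:E); field.
exists w, ((p ^+ 2 + sg ^+ 2) * t ^+ 3 / 12); split => //.
- move=> d d0; apply: steer_bridge; split => /=.
  + by rewrite lexx ltW.
  + by rewrite x1E; ring.
  + by rewrite x2E; ring.
  + by left.
  + move=> s /andP[s0 st]; rewrite /kinked x2E mul0r addr0.
    rewrite (_ : _ + _ = 2 * sg * (t - s) + d * sg * (s * (t - s))); last by ring.
    have ts : 0 <= t - s by rewrite subr_ge0.
    by apply: addr_ge0; apply: mulr_ge0; rewrite ?mulr_ge0.
- move=> s /andP[s0 st]; rewrite costE// lee_fin cal.
  rewrite expr0n /= mulr0 mul0r mul0r subr0 addr0 le_max.
  have [L|L] := leP (p ^+ 2 + sg ^+ 2 - 1) 0.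
    by rewrite mulr_ge0_le0.
  by rewrite ler_wpM2r ?orbT// ltW.
- by move=> d; rewrite costE ?lexx ?(ltW t0)// cal; congr (_%:E); field.
- rewrite cal => /eqP; rewrite mulf_eq0 (negbTE t_neq0) /= subr_eq0 => /eqP psg.
  move=> d s d0 /andP[s0 st].
  rewrite (_ : calibration _ _ _ _ _ = (t - s) * (p ^+ 2 + sg ^+ 2 - 1) +
      d * (s * (t - s)) * (p ^+ 2 + sg ^+ 2)); last first.
    by rewrite /calibration /= /kinked x1E x2E; ring.
  by rewrite psg subrr mulr0 add0r mulr1 !mulr_gt0// subr_gt0.
Qed.

(** The path reaches the road at time [s0 = x_2 / (2 g)], before [t] because
    [sg < g].  The running cost is [L] before [s0] and [L + k] after it; as
    [0 <= k], the accumulated cost is convex and lies below its chord. *)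
Lemma optimal_road a b c x t p : 0 < a -> half_plane x -> 0 < t ->
  let sg := x.2 / (2 * t) in
  let g := road_gain a b p in
  sg < g -> x.1 - c * t + 2 * t * p + 2 * t * (g - sg) * (2 * a * p - b) = 0 ->
  exists w k, optimal_family a b c x t p g w k.
Proof.
move=> a0 x2 t0 sg g sg_lt eqp.
have t_neq0 : t != 0 by rewrite gt_eqF.
have sg0 : 0 <= sg by rewrite divr_ge0// mulr_ge0// ltW.
have g0 : 0 < g := le_lt_trans sg0 sg_lt.
have g_neq0 : g != 0 by rewrite gt_eqF.
have p_neq0 : p != 0.
  by apply/eqP => p0; move: g0; rewrite /g /road_gain p0 expr0n/= !mulr0 subrr ltxx.
pose s0 := x.2 / (2 * g).
have s0_ge0 : 0 <= s0 by rewrite divr_ge0// mulr_ge0// ltW.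
have x2E : x.2 = 2 * g * s0 by rewrite /s0; field.
have sgE : t * sg = g * s0.
  by rewrite /sg /s0; field; rewrite g_neq0 t_neq0.
have s0_lt : s0 < t.
  by rewrite -(ltr_pM2l g0) -sgE mulrC ltr_pM2r.
have x1E : x.1 = c * t - 2 * t * p - 2 * g * (2 * a * p - b) * (t - s0).
  move: eqp; rewrite (_ : 2 * t * (g - sg) = 2 * (t * g - t * sg)); last by ring.
  by rewrite sgE => eqp; apply/eqP; rewrite -subr_eq0 -eqp; apply/eqP; ring.
have gG : road_gain a b p = g by [].
have gE : g = a * p ^+ 2 - b * p by [].
clearbody g sg s0.
pose C := (2 * g * (2 * a * p - b), 2 * g).
pose w d := steer x (2 * p - c, - (2 * g)) C (- (d * p), 0) s0 t.
have rcE : road_cost a b C = 2 * g * a * p ^+ 2.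
  rewrite /road_cost /= mulr_gt0// /Gcost; field.
  by rewrite gt_eqF.
pose L := p ^+ 2 + g ^+ 2 - 1; pose k := 2 * g * a * p ^+ 2.
have k0 : 0 <= k by rewrite /k mulr_ge0 ?sqr_ge0// mulr_ge0 ?mulr_ge0// ltW.
have cal : calibration c p g x t = t * L + k * (t - s0).
  rewrite /calibration x1E x2E /k /L gE; ring.
have costE d s : 0 <= s -> s <= t -> cost a b c (w d) s =
    (s * L + k * Num.max (s - s0) 0 - d * p ^+ 2 * (s * (t - s)) +
    p ^+ 2 / 24 * (t ^+ 3 - (t - 2 * s) ^+ 3) * d ^+ 2)%:E.
  move=> s0' st; rewrite cost_steer ?(ltW t0)// rcE /=.
  by congr (_%:E); rewrite /L /k; field.
have maxt : Num.max (t - s0) 0 = t - s0 by rewrite max_l ?subr_ge0 ?ltW.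
have cost0 s : 0 <= s <= t -> s * L + k * Num.max (s - s0) 0 <=
    s / t * (t * L + k * (t - s0)).
  move=> /andP[s0' st].
  have -> : s / t * (t * L + k * (t - s0)) = s * L + k * (s / t * (t - s0)).
    by field.
  rewrite lerD2l ler_wpM2l// ge_max; apply/andP; split; last first.
    by rewrite mulr_ge0 ?divr_ge0 ?subr_ge0// ltW.
  rewrite mulrBr divfK// lerD2l lerN2 ler_piMl// ler_pdivrMr// mul1r//.
exists w, (p ^+ 2 * t ^+ 3 / 12); split.
- by split; [exact: ltW|rewrite gG].
- move=> d d0; apply: steer_bridge; split => /=.
  + by rewrite s0_ge0 ltW.
  + by rewrite x1E; ring.
  + by rewrite x2E; ring.
  + by right; split => //; rewrite mulr_gt0.
  + move=> s /andP[s0' st]; rewrite /kinked x2E mul0r addr0.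
    set m := Num.max _ _; rewrite (_ : _ + _ = 2 * g * (m - (s - s0))); last by ring.
    by rewrite !mulr_ge0 ?subr_ge0 ?le_max ?lexx// ltW.
- move=> s st; move: (st) => /andP[s0' st']; rewrite costE// lee_fin cal.
  rewrite expr0n /= mulr0 mul0r mul0r subr0 addr0.
  apply: le_trans (cost0 _ st) _; set q := t * L + _.
  have s1 : 0 <= s / t <= 1.
    by rewrite divr_ge0 ?ler_pdivrMr ?mul1r// ltW.
  case/andP: s1 => s1 s2; rewrite le_max; have [q0|q0] := leP q 0.
    by rewrite mulr_ge0_le0.
  by rewrite ler_piMl ?orbT// ltW.
- by move=> d; rewrite costE ?lexx ?(ltW t0)// cal maxt; congr (_%:E); field.
- rewrite cal => cal0 d s d0 /andP[s0' st].
  have st' : 0 <= s <= t by rewrite !ltW.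
  have := cost0 _ st'; rewrite cal0 mulr0 => le0.
  set m := Num.max (s - s0) 0 in le0.
  rewrite (_ : calibration _ _ _ _ _ = (t * L + k * (t - s0)) - (s * L + k * m) +
      d * (s * (t - s)) * p ^+ 2); last first.
    rewrite /calibration /= /kinked x1E x2E -/m /L /k; clearbody m; rewrite gE; ring.
  rewrite cal0 sub0r; apply: ltr_wpDl; first by rewrite oppr_ge0.
  apply: mulr_gt0; last by rewrite exprn_even_gt0.
  by rewrite !mulr_gt0// subr_gt0.
Qed.

Lemma optimal_family_exists a b c x t : 0 < a -> half_plane x -> 0 < t ->
  exists p r w k, optimal_family a b c x t p r w k.
Proof.
move=> a0 x2 t0.
have [p] := critical_slope b (x.1 - c * t) (x.2 / (2 * t)) a0 t0.
have [Gp|Gp] := leP (road_gain a b p) (x.2 / (2 * t)).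
  rewrite max_r ?subr_le0// mulr0 mul0r addr0 => /eqP; rewrite addrC addr_eq0.
  move=> /eqP pE; have t_neq0 : t != 0 by rewrite gt_eqF.
  have {}pE : p = - (x.1 - c * t) / (2 * t) by rewrite -pE; field.
  have [|w [k H]] := @optimal_field a b c x t x2 t0; first by rewrite -pE.
  by exists p, (x.2 / (2 * t)), w, k; rewrite pE.
rewrite max_l ?subr_ge0 1?ltW// => eqp.
have [w [k H]] := optimal_road a0 x2 t0 Gp eqp.
by exists p, (road_gain a b p), w, k.
Qed.

End Optimal.

(** * The action, the value and the zero level set *)

Section Value.
Context {R : realType}.
Implicit Types (a b c p r s t k : R) (x : R * R).
Local Notation mu := (@lebesgue_measure R).

Lemma calibration_le_J a b c p r x t : 0 < a -> 0 <= t -> admissible a b p r ->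
  ((calibration c p r x t)%:E <= J a b c x t)%E.
Proof.
by move=> a0 t0 pr; apply: le_ereal_inf_tmp => _ [u ub <-]; exact: calibration_le_cost.
Qed.

Lemma optimal_J a b c x t p r w k : 0 < a -> 0 <= t ->
  optimal_family a b c x t p r w k -> J a b c x t = (calibration c p r x t)%:E.
Proof.
move=> a0 t0 [pr wb _ wt _]; apply/eqP; rewrite eq_le calibration_le_J// andbT.
apply: ereal_inf_lbound; exists (w 0); first exact: wb.
by rewrite wt expr0n mulr0 addr0.
Qed.

Lemma cost_at0 a b c u : cost a b c u 0 = 0%E.
Proof. by rewrite /cost set_itv1 integral_set1. Qed.

Lemma stopping_time_cst k : 0 <= k -> @stopping_time R (fun=> k).
Proof. by move=> k0; split. Qed.

Lemma value_eq a b c x t : 0 < a -> half_plane x -> 0 < t ->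
  value a b c x t = Order.max 0%E (J a b c x t).
Proof.
move=> a0 x2 t0; have [p [r [w [k H]]]] := optimal_family_exists b c a0 x2 t0.
have JE := optimal_J a0 (ltW t0) H.
apply/eqP; rewrite eq_le; apply/andP; split.
  apply: ge_ereal_sup => _ [th [th0 _] <-].
  case: H => _ wb wc _ _; have w0 := wb 0 (lexx 0).
  apply: (@le_trans _ _ (cost a b c (w 0) (Num.min t (th (extend t (gam (w 0))))))).
    by apply: ereal_inf_lbound; exists (w 0).
  rewrite JE -EFin_max; apply: wc.
  rewrite ge_min lexx le_min (ltW t0) /= andbT.
  exact/th0/(L2path_extend (proj1 w0)).
rewrite ge_max; apply/andP; split.
  apply: le_trans (ereal_sup_ubound _); last first.
    by exists (fun=> 0); first exact: stopping_time_cst.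
  apply: le_ereal_inf_tmp => _ [u _ <-].
  by rewrite min_r ?(ltW t0)// cost_at0.
apply: ereal_sup_ubound; exists (fun=> t).
  exact/stopping_time_cst/ltW.
by rewrite minxx.
Qed.

(** The modulus is proportional to [1 + p^2 + r^2], the quantity controlled by
    the coercivity of the calibration in [calibration_stable]. *)
Lemma calibration_lipschitz c p r x t (y : R * R) s (e : R) :
  `|x.1 - y.1| <= e -> `|x.2 - y.2| <= e -> `|t - s| <= e ->
  `|calibration c p r x t - calibration c p r y s| <=
    e * (3 + `|c|) * (1 + p ^+ 2 + r ^+ 2).
Proof.
move=> x1 x2 ts; have e0 : 0 <= e := le_trans (normr_ge0 _) ts.
have ab y' : `|y'| <= 1 + y' ^+ 2 :> R.
  rewrite -[y' ^+ 2]real_normK ?num_real//.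
  by have := sqr_ge0 (`|y'| - 1); have := sqr_ge0 `|y'|; rewrite sqrrB1; lra.
have pS : `|p| <= 1 + p ^+ 2 + r ^+ 2 by rewrite (le_trans (ab p))// lerDl sqr_ge0.
have rS : `|r| <= 1 + p ^+ 2 + r ^+ 2.
  by rewrite (le_trans (ab r))// lerD2r lerDl sqr_ge0.
have S0 : 0 <= 1 + p ^+ 2 + r ^+ 2 by rewrite !addr_ge0 ?sqr_ge0.
set S := 1 + p ^+ 2 + r ^+ 2 in pS rS S0 *.
have -> : calibration c p r x t - calibration c p r y s = - p * (x.1 - y.1) +
    p * c * (t - s) + r * (x.2 - y.2) - (t - s) * S.
  by rewrite /calibration -/S; ring.
have -> : e * (3 + `|c|) * S = S * e + S * `|c| * e + S * e + e * S by ring.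
rewrite (le_trans (ler_normB _ _))//; apply: lerD; last first.
  by rewrite normrM (ger0_norm S0) ler_wpM2r.
rewrite (le_trans (ler_normD _ _))//; apply: lerD; last first.
  by rewrite normrM ler_pM.
rewrite (le_trans (ler_normD _ _))//; apply: lerD.
  by rewrite normrM normrN ler_pM.
by rewrite !normrM; apply: ler_pM => //; apply: ler_pM.
Qed.

(** The neighbourhood is uniform in the slopes.  Besides the bound [- m], the
    calibration is at most [Q - t / 2 (1 + p^2 + r^2)]; a convex combination of the
    two bounds is a negative multiple of [1 + p^2 + r^2], which absorbs
    the variation given by [calibration_lipschitz]. *)
Lemma calibration_stable c x t m : 0 < t -> 0 < m -> exists2 e : R, 0 < e &
  forall p r, calibration c p r x t <= - m -> forall (y : R * R) s,
  `|x.1 - y.1| <= e -> `|x.2 - y.2| <= e -> `|t - s| <= e ->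
  calibration c p r y s <= 0.
Proof.
move=> t0 m0; pose X := x.1 - c * t; pose Q := (X ^+ 2 + x.2 ^+ 2) / (2 * t).
have Q0 : 0 <= Q by rewrite divr_ge0 ?addr_ge0 ?sqr_ge0 ?mulr_ge0// ltW.
(* weight for which the constant terms of the two bounds cancel *)
pose l := m / (m + Q); have mQ : 0 < m + Q by rewrite ltr_pwDl.
have l0 : 0 < l by rewrite divr_gt0.
have lQ : l * Q = (1 - l) * m by rewrite /l; field; rewrite gt_eqF.
have l1 : l <= 1 by rewrite ler_pdivrMr// mul1r lerDl.
clearbody l.
have c0 : 0 < 3 + `|c| by rewrite ltr_pwDl.
exists (l * (t / 2) / (3 + `|c|)).
  by apply: divr_gt0 => //; apply: mulr_gt0 => //; exact: divr_gt0.
move=> p r pr y s x1 x2 ts.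
have S0 : 0 <= 1 + p ^+ 2 + r ^+ 2 by rewrite !addr_ge0 ?sqr_ge0.
have coercive : calibration c p r x t <= Q - t / 2 * (1 + p ^+ 2 + r ^+ 2).
  rewrite -subr_ge0 (_ : _ - _ =
    ((X + t * p) ^+ 2 + (x.2 - t * r) ^+ 2) / (2 * t) + t / 2).
    by rewrite addr_ge0 ?divr_ge0 ?addr_ge0 ?sqr_ge0 ?mulr_ge0// ltW.
  by rewrite /calibration /Q /X; field; rewrite gt_eqF.
clearbody Q.
have h1 : (1 - l) * calibration c p r x t <= (1 - l) * - m.
  by rewrite ler_wpM2l// subr_ge0.
have h2 : l * calibration c p r x t <= l * Q - l * (t / 2) * (1 + p ^+ 2 + r ^+ 2).
  by rewrite -mulrA -mulrBr ler_wpM2l// ltW.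
have h3 : calibration c p r y s - calibration c p r x t <=
    l * (t / 2) * (1 + p ^+ 2 + r ^+ 2).
  have := calibration_lipschitz c p r x1 x2 ts; rewrite divfK ?gt_eqF//.
  by rewrite distrC; apply: le_trans; exact: ler_norm.
rewrite lQ in h2; rewrite mulrN in h1; rewrite mulrBl mul1r in h1.
lra.
Qed.

(** The action is a maximum of calibrations.  If it is positive at a point, one
    calibration is positive nearby; if it is negative, all calibrations are
    nonpositive nearby. *)
Lemma boundary_optimal0 a b c x t p r w k : 0 < a -> 
  optimal_family a b c x t p r w k ->
  rel_boundary (@spacetime R) (Pset a b c) (x, t) -> calibration c p r x t = 0.
Proof.
move=> a0 H [[[/= x2 t0] clP] clN]; have JE := optimal_J a0 (ltW t0) H.
have near_xt (e : R) : 0 < e -> nbhs (x, t) [set z : R * R * R |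
    [/\ `|x.1 - z.1.1| <= e, `|x.2 - z.1.2| <= e & `|t - z.2| <= e]].
  move=> e0; apply/nbhs_ballP; exists e => //= -[[y1 y2] s] [[/= h1 h2] h3].
  by split; exact: ltW.
apply/eqP; rewrite eq_le; apply/andP; split; rewrite leNgt; apply/negP.
- move=> cal0; pose S := 1 + p ^+ 2 + r ^+ 2.
  have S0 : 0 < S by rewrite /S -addrA ltr_pwDl ?addr_ge0 ?sqr_ge0.
  have c0 : 0 < 3 + `|c| by rewrite ltr_pwDl.
  pose e := calibration c p r x t / 2 / S / (3 + `|c|).
  have e0 : 0 < e by do 3 apply: divr_gt0 => //.
  have [[y s] [[[/= y2 s0] nP] [/= h1 h2 h3]]] := clN _ (near_xt e e0).
  have pr : admissible a b p r by case: H.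
  apply: nP; split=> //=.
  apply: lt_le_trans (calibration_le_J c y a0 (ltW s0) pr).
  have := calibration_lipschitz c p r h1 h2 h3.
  rewrite -/S /e !divfK ?gt_eqF//.
  by rewrite lte_fin ler_norml => /andP[_]; lra.
- move=> cal0; have m0 : 0 < - calibration c p r x t by rewrite oppr_gt0.
  have [e e0 He] := calibration_stable c x t0 m0.
  have [[y s] [[[/= y2 s0] Jpos] [/= h1 h2 h3]]] := clP _ (near_xt e e0).
  have [p' [r' [w' [k' H']]]] := optimal_family_exists b c a0 y2 s0.
  move: Jpos; rewrite /= (optimal_J a0 (ltW s0) H') lte_fin ltNge => /negP; apply.
  apply: (He p' r' _ y s h1 h2 h3); rewrite opprK -lee_fin -JE.
  by apply: calibration_le_J (ltW t0) _ => //; case: H'.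
Qed.

Lemma J_in_P_eq a b c x t : 0 < a ->
  rel_boundary (@spacetime R) (Pset a b c) (x, t) ->
  J a b c x t = J_in_P a b c x t.
Proof.
move=> a0 bd; have [[[/= x2 t0] _] _] := bd.
have [p [r [w [k H]]]] := optimal_family_exists b c a0 x2 t0.
have cal0 := boundary_optimal0 a0 H bd.
have JE := optimal_J a0 (ltW t0) H; rewrite cal0 in JE.
apply/eqP; rewrite eq_le; apply/andP; split.
  by apply: ereal_inf_le_tmp => _ [u [ub _] <-]; exists u.
case: H => pr wb _ wt wP; rewrite JE; apply/lee_addgt0Pr => e e0; rewrite add0e.
have k0 : 0 < `|k| + 1 by rewrite ltr_wpDl.
(* [d <= 1] gives [k d^2 <= |k| d <= e] *)
pose d := Num.min 1 (e / (`|k| + 1)).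
have d0 : 0 < d by rewrite lt_min ltr01 divr_gt0.
apply: (@le_trans _ _ (cost a b c (w d) t)).
  apply: ereal_inf_lbound; exists (w d) => //; split; first exact/wb/ltW.
  have [ct _] := wb d (ltW d0).
  move=> s /[dup] st /andP[s0 s1]; split; first split => /=.
  - by apply: (ct_half_plane ct); rewrite in_itv/= !ltW.
  - by rewrite subr_gt0.
  - have ts : 0 <= t - s by rewrite subr_ge0 ltW.
    apply: lt_le_trans (calibration_le_J c _ a0 ts pr).
    by rewrite lte_fin; exact: wP.
rewrite wt cal0 add0r lee_fin.
have d1 : d <= 1 by rewrite ge_min lexx.
have de : d * (`|k| + 1) <= e by rewrite -ler_pdivlMr// ge_min lexx orbT.
apply: le_trans de; rewrite (le_trans (ler_norm _))// normrM (ger0_norm (sqr_ge0 d)).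
rewrite (_ : `|k| * d ^+ 2 = d * (d * `|k|)); last by ring.
rewrite ler_wpM2l ?(ltW d0)// (@le_trans _ _ `|k|) ?lerDl//.
by rewrite ler_piMl.
Qed.

End Value.

Theorem theorem4 (R : realType) (a b c : R)
    (ha : 0 < a) (hb : 0 < b) (hc : 0 < c) :
  (forall (x : R * R) (t : R),
     rel_boundary (@spacetime R) (Pset a b c) (x, t) ->
     J a b c x t = J_in_P a b c x t) /\
  (forall (x : R * R) (t : R), half_plane x -> 0 < t ->
     value a b c x t = Order.max 0%E (J a b c x t)).
Proof.
split=> x t; first exact: J_in_P_eq.
exact: value_eq.
Qed.
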